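(* The set of nilpotent elements of the projective class ring $p(H_{n,d})$ is equal to the set of nilpotent elements of the Green ring $r(H_{n,d})$.
   Context: Let $K$ be an algebraically closed field of characteristic $0$, let $n,d\geq 2$ be integers with $d\mid n$, and let $q\in K$ be a primitive $d$-th root of unity. The generalized Taft algebra $H_{n,d}=H_{n,d}(q)$ is the $K$-algebra generated by $g,h$ subject to $g^n=1$, $h^d=0$, $hg=qgh$; it is a Hopf algebra of dimension $nd$ with $\Delta(g)=g\otimes g$, $\Delta(h)=1\otimes h+h\otimes g$, $\varepsilon(g)=1$, $\varepsilon(h)=0$, $S(g)=g^{-1}$, $S(h)=-q^{-1}g^{n-1}h$. Modules are finite dimensional left modules; tensor products of modules are over $K$ with action through $\Delta$. The Green ring $r(H)$ of a Hopf algebra $H$ is the abelian group generated by isomorphism classes $[V]$ of finite dimensional $H$-modules modulo $[V\oplus W]=[V]+[W]$, with multiplication $[V][W]=[V\otimes W]$. The projective class ring $p(H_{n,d})$ is the subring of $r(H_{n,d})$ generated by the classes of projective and of semisimple $H_{n,d}$-modules. *)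

(* Defs.v *)
From HB Require Import structures.
From mathcomp Require Import all_boot all_algebra.
From mathcomp Require Import finmap.
From mathcomp Require Import boolp classical_sets.
From mathcomp.real_closed Require Import mxtens.
From mathcomp.multinomials Require Import monalg.
From mathcomp Require Import ring.

Set Implicit Arguments.
Unset Strict Implicit.
Unset Printing Implicit Defensive.

Import GRing.Theory.
Local Open Scope ring_scope.
Local Open Scope quotient_scope.

Section FreeAlgebra.
Variable K : fieldType.

(* [K<g,h>]; the letter [true] stands for g and [false] for h. *)
Definition free_gh := {malg K[{fmonom bool}]}.
HB.instance Definition _ := GRing.Lalgebra.on free_gh.

Definition free_g : free_gh := << fmu true >>.
Definition free_h : free_gh := << fmu false >>.

Lemma free_ind (P : free_gh -> Prop) :
  (forall a x y, P x -> P y -> P (a *: x + y)) ->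
  (forall x y, P x -> P y -> P (x * y)) -> P 1 -> P free_g -> P free_h ->
  forall x, P x.
Proof.
move=> PD PM P1 Pg Ph.
have P0 : P 0 by rewrite -(addNr 1) -scaleN1r; apply: PD.
have PZ a x : P x -> P (a *: x) by move=> Px; rewrite -[_ *: _]addr0; apply: PD.
have Pw (w : seq bool) : P << FMonom w >>.
  elim: w => [|b w IH]; first by rewrite -fmoneE.
  have -> : (<< FMonom (b :: w) >> : free_gh) = << fmu b >> * << FMonom w >>.
    rewrite malgM_def fgmulUU mulr1; congr mkmalgU.
    by apply/eqP; rewrite fmP fmM fmU.
  by apply: PM; [case: b | exact: IH].
move=> x; rewrite [x]monalgE; elim/big_ind: _ => //.
  by move=> y z Py Pz; rewrite -[y]scale1r; apply: PD.
move=> w _; rewrite -[w]fmK.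
have -> : (<< x@_(FMonom w) *g FMonom w >> : free_gh) =
          x@_(FMonom w) *: << FMonom w >>.
  by apply/malgP => v; rewrite mcoeffZ mcoeffU [in RHS]mcoeffU mulrnAr mulr1.
exact/PZ/Pw.
Qed.

Lemma free_scaleAr a (x y : free_gh) : a *: (x * y) = x * (a *: y).
Proof.
have C (z : free_gh) : z * a%:MP = a *: z.
  rewrite [z]monalgE mulr_suml scaler_sumr; apply: eq_bigr => w _.
  rewrite malgM_def fgmulUU mulm1; apply/malgP => v.
  by rewrite mcoeffZ mcoeffU [in RHS]mcoeffU mulrC mulrnAr.
by rewrite -[a *: y]mul_malgC mulrA C -scalerAl.
Qed.
HB.instance Definition _ := GRing.Lalgebra_isAlgebra.Build K free_gh free_scaleAr.

End FreeAlgebra.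

Section TaftIdeal.
Variables (K : fieldType) (n d : nat) (q : K).
Local Notation g := (free_g K).
Local Notation h := (free_h K).

Inductive in_taft_ideal : free_gh K -> Prop :=
| taft_ideal_gn : in_taft_ideal (g ^+ n - 1)
| taft_ideal_hd : in_taft_ideal (h ^+ d)
| taft_ideal_hg : in_taft_ideal (h * g - q *: (g * h))
| taft_ideal0 : in_taft_ideal 0
| taft_idealD x y : in_taft_ideal x -> in_taft_ideal y -> in_taft_ideal (x + y)
| taft_idealM a x b : in_taft_ideal x -> in_taft_ideal (a * x * b).

Definition taft_ideal : {pred free_gh K} := fun x => `[< in_taft_ideal x >].

Lemma taft_ideal_zmod_closed : zmod_closed taft_ideal.
Proof.
split=> [|x y /asboolP Ix /asboolP Iy]; first exact/asboolP/taft_ideal0.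
apply/asboolP/taft_idealD => //.
by have := taft_idealM (-1) 1 Iy; rewrite mulr1 mulN1r.
Qed.
HB.instance Definition _ :=
  GRing.isZmodClosed.Build (free_gh K) taft_ideal taft_ideal_zmod_closed.

Lemma taft_idealMM a b x : x \in taft_ideal -> a * x * b \in taft_ideal.
Proof. by move/asboolP=> Ix; apply/asboolP/taft_idealM. Qed.

Variables (m : nat) (G X : 'M[K]_m).

Definition word_mx (w : seq bool) : 'M[K]_m :=
  foldr (fun b A => (if b then G else X) *m A) 1%:M w.

Definition free_mx (x : free_gh K) : 'M[K]_m :=
  \sum_(w <- msupp x) x@_w *: word_mx w.

Lemma free_mxEw (D : {fset {fmonom bool}}) x : (msupp x `<=` D)%fset ->
  free_mx x = \sum_(w <- D) x@_w *: word_mx w.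
Proof.
move=> le; rewrite /free_mx (big_fset_incl _ le) // => w _ /mcoeff_outdom ->.
by rewrite scale0r.
Qed.

Lemma free_mx_linear : linear free_mx.
Proof.
move=> a x y; set D := (msupp x `|` msupp y)%fset.
rewrite !(@free_mxEw D) ?fsubsetUl ?fsubsetUr //; last first.
  by rewrite (fsubset_trans (msuppD_le _ _)) // fsetUSS // msuppZ_le.
rewrite scaler_sumr -big_split; apply: eq_bigr => w _ /=.
by rewrite mcoeffD mcoeffZ scalerDl scalerA.
Qed.
HB.instance Definition _ := GRing.isLinear.Build K (free_gh K) 'M[K]_m *:%R
  free_mx free_mx_linear.

Lemma free_mxB x y : free_mx (x - y) = free_mx x - free_mx y.
Proof. exact: linearB. Qed.
Lemma free_mxD x y : free_mx (x + y) = free_mx x + free_mx y.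
Proof. exact: linearD. Qed.
Lemma free_mxZ a x : free_mx (a *: x) = a *: free_mx x.
Proof. exact: linearZ. Qed.
Lemma free_mx0 : free_mx 0 = 0.
Proof. exact: linear0. Qed.

Lemma free_mxU a w : free_mx << a *g w >> = a *: word_mx w.
Proof.
rewrite (@free_mxEw [fset w]%fset) ?msuppU_le // big_seq_fset1.
by rewrite mcoeffU eqxx.
Qed.

Lemma word_mx_cat u v : word_mx (u ++ v) = word_mx u *m word_mx v.
Proof. by elim: u => [|b u IH] /=; rewrite ?mul1mx // IH mulmxA. Qed.

Lemma free_mx1 : free_mx 1 = 1%:M.
Proof. by rewrite free_mxU scale1r fm1. Qed.

Lemma free_mxg : free_mx g = G.
Proof. by rewrite free_mxU scale1r fmU /= mulmx1. Qed.

Lemma free_mxh : free_mx h = X.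
Proof. by rewrite free_mxU scale1r fmU /= mulmx1. Qed.

Lemma free_mxM x y : free_mx (x * y) = free_mx x *m free_mx y.
Proof.
rewrite malgME [in RHS]/free_mx mulmx_suml linear_sum; apply: eq_bigr => u _.
rewrite mulmx_sumr linear_sum; apply: eq_bigr => v _ /=.
by rewrite free_mxU fmM word_mx_cat -scalemxAl -scalemxAr scalerA.
Qed.

Lemma free_mxX x k : free_mx (x ^+ k) = (free_mx x : 'M[K]_m) ^+ k.
Proof.
by elim: k => [|k IH]; rewrite ?expr0 ?free_mx1 // !exprS free_mxM IH mulmxE.
Qed.

#[local] Opaque free_g free_h.

Hypotheses (Gn : G ^+ n = 1 :> 'M[K]_m) (Xd : X ^+ d = 0 :> 'M[K]_m).
Hypothesis XG : X *m G = q *: (G *m X).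

Lemma free_mx_ideal x : x \in taft_ideal -> free_mx x = 0.
Proof.
move/asboolP; elim=> [|||| y z _ Hy _ Hz|a y b _ Hy].
- by rewrite free_mxB free_mxX free_mxg Gn free_mx1 subrr.
- by rewrite free_mxX free_mxh.
- rewrite free_mxB free_mxZ; apply/eqP; rewrite subr_eq0; apply/eqP.
  transitivity (X *m G); first by rewrite free_mxM free_mxg free_mxh.
  by rewrite XG; congr (_ *: _); rewrite free_mxM free_mxg free_mxh.
- exact: free_mx0.
- by rewrite free_mxD Hy Hz addr0.
- by rewrite 2!free_mxM Hy mulmx0 mul0mx.
Qed.

End TaftIdeal.

Section TaftAlgebra.
Variables (K : fieldType) (n d : nat) (q : K).

(* K<g,h> modulo the relations. The phantom argument only serves to attach the
   structures that need it: 1 != 0 here, and tensor products of modules below. *)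
Definition taft (hq : d.-primitive_root q) : Type :=
  Quotient.quot (taft_ideal n d q).

Variable hq : d.-primitive_root q.
Local Notation H := (taft hq).
HB.instance Definition _ := GRing.Zmodule.on H.
HB.instance Definition _ := Quotient.on H.

Definition taft_pi (x : free_gh K) : H := \pi x.
Local Notation pi := taft_pi.

Variant taft_spec : H -> Prop := TaftSpec u : taft_spec (pi u).
Lemma taftP x : taft_spec x.
Proof. by rewrite -[x]reprK; apply: TaftSpec. Qed.

Lemma taft_piP x y : reflect (pi x = pi y) (x - y \in taft_ideal n d q).
Proof. by rewrite /taft_pi Quotient.idealrBE; apply: eqP. Qed.

Lemma taft_repr x : repr (pi x) - x \in taft_ideal n d q.
Proof. by apply/taft_piP; rewrite /taft_pi reprK. Qed.

Definition taft_one : H := pi 1.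
Definition taft_mul (x y : H) : H := pi (repr x * repr y).
Definition taft_scale (a : K) (x : H) : H := pi (a *: repr x).

Lemma pi_taft_mul x y : taft_mul (pi x) (pi y) = pi (x * y).
Proof.
apply/taft_piP; set x' := repr _; set y' := repr _.
have -> : x' * y' - x * y = 1 * (x' - x) * y' + x * (y' - y) * 1.
  by rewrite mul1r mulr1 mulrBl mulrBr addrA subrK.
by rewrite rpredD // taft_idealMM // taft_repr.
Qed.

Lemma pi_taft_scale a x : taft_scale a (pi x) = pi (a *: x).
Proof.
apply/taft_piP; rewrite -scalerBr -mul_malgC -[_ * _]mulr1.
exact/taft_idealMM/taft_repr.
Qed.

Lemma pi_taftD x y : pi x + pi y = pi (x + y).
Proof. by rewrite /taft_pi !piE. Qed.

Definition taft_piE := (pi_taft_mul, pi_taft_scale, pi_taftD).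

Lemma taft_mulA : associative taft_mul.
Proof.
by move=> x y z; case: (taftP x) (taftP y) (taftP z) => [{}x [{}y] [{}z]]; rewrite !taft_piE mulrA.
Qed.
Lemma taft_mul1 : left_id taft_one taft_mul.
Proof. by move=> x; case: (taftP x) => {}x; rewrite !taft_piE mul1r. Qed.
Lemma taft_mulr1 : right_id taft_one taft_mul.
Proof. by move=> x; case: (taftP x) => {}x; rewrite !taft_piE mulr1. Qed.
Lemma taft_mulDl : left_distributive taft_mul +%R.
Proof.
by move=> x y z; case: (taftP x) (taftP y) (taftP z) => [{}x [{}y] [{}z]]; rewrite !taft_piE mulrDl.
Qed.
Lemma taft_mulDr : right_distributive taft_mul +%R.
Proof.
by move=> x y z; case: (taftP x) (taftP y) (taftP z) => [{}x [{}y] [{}z]]; rewrite !taft_piE mulrDr.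
Qed.
Lemma taft_one_neq0 : taft_one != 0.
Proof.
have -> : (0 : H) = pi 0 by rewrite /taft_pi piE.
apply/eqP => /taft_piP; rewrite subr0 => /(free_mx_ideal (m := 1) (G := 1) (X := 0)).
rewrite free_mx1 => /(_ _ _ _)/matrixP; move/(_ _ _ _ 0 0); rewrite !mxE.
have d_gt0 := prim_order_gt0 hq.
have E : (1%:R : K) != 0 by exact: oner_neq0.
move=> E'; move/eqP: E; apply; apply: E'.
- exact: expr1n.
- by rewrite expr0n -[d]prednK.
- by rewrite mul0mx mulmx0 scaler0.
Qed.
HB.instance Definition _ := GRing.Zmodule_isNzRing.Build H
  taft_mulA taft_mul1 taft_mulr1 taft_mulDl taft_mulDr taft_one_neq0.

Lemma taft_scaleA a b x : taft_scale a (taft_scale b x) = taft_scale (a * b) x.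
Proof. by case: (taftP x) => {}x; rewrite !taft_piE scalerA. Qed.
Lemma taft_scale1 : left_id 1 taft_scale.
Proof. by move=> x; case: (taftP x) => {}x; rewrite !taft_piE scale1r. Qed.
Lemma taft_scaleDr : right_distributive taft_scale +%R.
Proof. by move=> a x y; case: (taftP x) (taftP y) => [{}x [{}y]]; rewrite !taft_piE scalerDr. Qed.
Lemma taft_scaleDl x : {morph taft_scale^~ x : a b / a + b}.
Proof. by move=> a b; case: (taftP x) => {}x; rewrite !taft_piE scalerDl. Qed.
HB.instance Definition _ := GRing.Zmodule_isLmodule.Build K H
  taft_scaleA taft_scale1 taft_scaleDr taft_scaleDl.

Lemma taft_piM x y : pi (x * y) = pi x * pi y.
Proof. by rewrite -pi_taft_mul. Qed.
Lemma taft_piZ a x : pi (a *: x) = a *: pi x.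
Proof. by rewrite -pi_taft_scale. Qed.
Lemma taft_scaleAl a (x y : H) : a *: (x * y) = a *: x * y.
Proof.
case: (taftP x) (taftP y) => [{}x [{}y]].
by rewrite -taft_piM -!taft_piZ -taft_piM scalerAl.
Qed.
HB.instance Definition _ := GRing.Lmodule_isLalgebra.Build K H taft_scaleAl.
Lemma taft_scaleAr a (x y : H) : a *: (x * y) = x * (a *: y).
Proof.
case: (taftP x) (taftP y) => [{}x [{}y]].
by rewrite -taft_piM -!taft_piZ -taft_piM scalerAr.
Qed.
HB.instance Definition _ := GRing.Lalgebra_isAlgebra.Build K H taft_scaleAr.

Definition taft_g : H := pi (free_g K).
Definition taft_h : H := pi (free_h K).

Lemma taft_piX x k : pi (x ^+ k) = pi x ^+ k.
Proof. by elim: k => [|k IH]; rewrite ?expr0 // !exprS taft_piM IH. Qed.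

Lemma taft_gn : taft_g ^+ n = 1.
Proof. by rewrite -taft_piX; apply/taft_piP/asboolP/taft_ideal_gn. Qed.
Lemma taft_hd : taft_h ^+ d = 0.
Proof.
have -> : (0 : H) = pi 0 by rewrite /taft_pi piE.
by rewrite -taft_piX; apply/taft_piP; rewrite subr0; apply/asboolP/taft_ideal_hd.
Qed.
Lemma taft_hg : taft_h * taft_g = q *: (taft_g * taft_h).
Proof.
by rewrite -!taft_piM -taft_piZ; apply/taft_piP/asboolP/taft_ideal_hg.
Qed.

Lemma taft_ind (P : H -> Prop) :
  (forall a x y, P x -> P y -> P (a *: x + y)) ->
  (forall x y, P x -> P y -> P (x * y)) -> P 1 -> P taft_g -> P taft_h ->
  forall x, P x.
Proof.
move=> PD PM P1 Pg Ph x; case: (taftP x) => {}x.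
elim/free_ind: x => // [a y z Py Pz|y z Py Pz].
  by rewrite -pi_taftD taft_piZ; apply: PD.
by rewrite taft_piM; apply: PM.
Qed.

End TaftAlgebra.

Section Kronecker.
Variable K : fieldType.

Lemma tensmx11 a b : 1%:M *t 1%:M = 1%:M :> 'M[K]_(a * b).
Proof.
apply/matrixP => i j; rewrite !mxE -natrM mulnb; congr _%:R; congr nat_of_bool.
exact: (can_eq (@mxtens_unindexK a b) i j).
Qed.

Lemma tensmxX a b (A : 'M[K]_a) (B : 'M[K]_b) k :
  (A *t B : 'M[K]_(a * b)) ^+ k = (A ^+ k : 'M[K]_a) *t (B ^+ k : 'M[K]_b).
Proof.
elim: k => [|k IH]; first by rewrite !expr0 tensmx11.
by rewrite !exprS IH -!mulmxE tensmx_mul.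
Qed.

Lemma tensmxDl a b c e (A A' : 'M[K]_(a, b)) (B : 'M[K]_(c, e)) :
  (A + A') *t B = A *t B + A' *t B.
Proof. by apply/matrixP => i j; rewrite !mxE mulrDl. Qed.
Lemma tensmxDr a b c e (B : 'M[K]_(c, e)) (A A' : 'M[K]_(a, b)) :
  B *t (A + A') = B *t A + B *t A'.
Proof. by apply/matrixP => i j; rewrite !mxE mulrDr. Qed.
Lemma tensmxZl a b c e k (A : 'M[K]_(a, b)) (B : 'M[K]_(c, e)) :
  (k *: A) *t B = k *: (A *t B).
Proof. by apply/matrixP => i j; rewrite !mxE mulrA. Qed.
Lemma tensmxZr a b c e k (A : 'M[K]_(a, b)) (B : 'M[K]_(c, e)) :
  A *t (k *: B) = k *: (A *t B).
Proof. by apply/matrixP => i j; rewrite !mxE mulrCA. Qed.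

Lemma addmxE a b (A B : 'M[K]_(a, b)) i j : (A + B) i j = A i j + B i j.
Proof. by rewrite mxE. Qed.

Lemma kron_comm a b (q : K) (X G : 'M[K]_a) (X' G' : 'M[K]_b) :
  X *m G = q *: (G *m X) -> X' *m G' = q *: (G' *m X') ->
  (1%:M *t X' + X *t G') *m (G *t G') = q *: ((G *t G') *m (1%:M *t X' + X *t G')).
Proof.
move=> XG XG'; rewrite mulmxDl mulmxDr !tensmx_mul mul1mx mulmx1 XG XG'.
by rewrite tensmxZl tensmxZr scalerDr.
Qed.

End Kronecker.

Fixpoint qbin (R : pzRingType) (q : R) (m k : nat) : R :=
  match m, k with
  | _, 0 => 1
  | 0, _.+1 => 0
  | m'.+1, k'.+1 => qbin q m' k' + q ^+ k * qbin q m' k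
  end.

Lemma qbin_gt (R : pzRingType) (q : R) m k : (m < k)%N -> qbin q m k = 0.
Proof.
elim: m k => [|m IH] [|k] //= lt_mk.
by rewrite !IH ?mulr0 ?addr0 // ltnW.
Qed.

Lemma qbinn (R : pzRingType) (q : R) m : qbin q m m = 1.
Proof. by elim: m => [|m IH] //=; rewrite IH qbin_gt // mulr0 addr0. Qed.

Lemma qbin_prod (K : fieldType) (q : K) m k : (k <= m)%N ->
  qbin q m k * \prod_(i < k) (q ^+ i.+1 - 1) = \prod_(i < k) (q ^+ (m - i) - 1).
Proof.
elim: m k => [|m IH] [|k] //= le_km; rewrite ?big_ord0 ?mulr1 //.
rewrite mulrDl [in RHS]big_ord_recl /= subn0.
have -> : \prod_(i < k) (q ^+ (m.+1 - bump 0 i) - 1) =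
          \prod_(i < k) (q ^+ (m - i) - 1) by apply: eq_bigr.
rewrite [X in X + _](_ : _ = \prod_(i < k) (q ^+ (m - i) - 1) * (q ^+ k.+1 - 1)).
  rewrite -mulrA; have [lt_km|] := ltnP k m.
    rewrite IH // big_ord_recr /=.
    have -> : q ^+ m.+1 = q ^+ k.+1 * q ^+ (m - k).
      by rewrite -exprD addSn subnKC // ltnW.
    by ring.
  move=> le_mk; have -> : k = m by apply/eqP; rewrite eqn_leq -ltnS le_km le_mk.
  by rewrite qbin_gt // mul0r mulr0 addr0 mulrC.
by rewrite big_ord_recr /= mulrA IH.
Qed.

Lemma qbin_eq0 (K : fieldType) (q : K) d k :
  d.-primitive_root q -> (0 < k < d)%N -> qbin q d k = 0.
Proof.
move=> hq /andP[k_gt0 lt_kd]; have := qbin_prod q (ltnW lt_kd).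
case: k k_gt0 lt_kd => // k _ lt_kd.
rewrite [RHS]big_ord_recl /= subn0 prim_expr_order // subrr mul0r.
move/eqP; rewrite mulf_eq0 => /orP[|]; first by move/eqP.
case/prodf_eq0 => i _.
rewrite subr_eq0 -(prim_order_dvd hq) => /dvdn_leq -/(_ isT).
by rewrite leqNgt (leq_ltn_trans (ltn_ord i) lt_kd).
Qed.

Section QBinomial.
Variables (K : fieldType) (q : K) (m : nat) (A B : 'M[K]_m).
Hypothesis AB : A *m B = q *: (B *m A).
Local Notation "M ^^ k" := (M ^+ k : 'M[K]_m) (at level 30).

Lemma qcommX k : A *m B ^^ k = q ^+ k *: (B ^^ k *m A).
Proof.
elim: k => [|k IH]; first by rewrite !expr0 scale1r mulmxE mulr1 mul1r.
rewrite exprS -mulmxE mulmxA AB -scalemxAl -mulmxA IH -scalemxAr scalerA.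
by rewrite -exprS mulmxA.
Qed.

Lemma qbinomial k :
  (A + B) ^^ k = \sum_(i < k.+1) qbin q k i *: (B ^^ i *m A ^^ (k - i)).
Proof.
elim: k => [|k IH].
  by rewrite big_ord_recl big_ord0 addr0 /= !expr0 mulmxE mulr1 scale1r.
rewrite exprS IH -mulmxE mulmxDl !mulmx_sumr.
have EA : \sum_(i < k.+1) A *m (qbin q k i *: (B ^^ i *m A ^^ (k - i))) =
   \sum_(i < k.+2) (q ^+ i * qbin q k i) *: (B ^^ i *m A ^^ (k.+1 - i)).
  rewrite [RHS]big_ord_recr /= qbin_gt // mulr0 scale0r addr0.
  apply: eq_bigr => i _; rewrite -scalemxAr mulmxA qcommX -scalemxAl scalerA.
  by rewrite mulrC -mulmxA subSn ?leq_ord // exprS mulmxE.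
have EB : \sum_(i < k.+1) B *m (qbin q k i *: (B ^^ i *m A ^^ (k - i))) =
   \sum_(i < k.+1) (qbin q k i) *: (B ^^ (i.+1) *m A ^^ (k.+1 - i.+1)).
  by apply: eq_bigr => i _; rewrite -scalemxAr mulmxA exprS subSS mulmxE.
rewrite EA EB big_ord_recl [RHS]big_ord_recl -addrA; congr (_ + _).
  by rewrite /= expr0 mul1r; case: (k).
rewrite -big_split; apply: eq_bigr => i _ /=.
by rewrite -scalerDl addrC.
Qed.

End QBinomial.

Section Modules.
Variables (K : fieldType) (n d : nat) (q : K) (hq : d.-primitive_root q).
Local Notation H := (taft n hq).

(* A finite dimensional left H-module; H acts on the column vectors of size hdim.
   The zero module (hdim = 0) is allowed. *)
Record hmodule := HModule {
  hdim : nat;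
  act : {linear H -> 'M[K]_hdim};
  act1 : act 1 = 1%:M;
  actM : forall x y, act (x * y) = act x *m act y }.

HB.instance Definition _ := gen_eqMixin hmodule.
HB.instance Definition _ := gen_choiceMixin hmodule.

Implicit Types V W U : hmodule.

Definition is_hom V W (f : 'M[K]_(hdim W, hdim V)) : Prop :=
  forall x : H, f *m act V x = act W x *m f.

Definition isomorphic V W : Prop :=
  exists f, exists2 f', @is_hom V W f & f *m f' = 1%:M /\ f' *m f = 1%:M.

Section Lift.
Variables (m : nat) (G X : 'M[K]_m).
Hypotheses (Gn : G ^+ n = 1 :> 'M[K]_m) (Xd : X ^+ d = 0 :> 'M[K]_m).
Hypothesis XG : X *m G = q *: (G *m X).

Definition taft_mx (x : H) : 'M[K]_m := free_mx G X (repr x).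

Lemma taft_mx_pi x : taft_mx (taft_pi n hq x) = free_mx G X x.
Proof.
apply/eqP; rewrite -subr_eq0 -linearB /=; apply/eqP.
exact: (free_mx_ideal Gn Xd XG (taft_repr _ _ _)).
Qed.

Lemma taft_mx_linear : linear taft_mx.
Proof.
move=> a x y; case: (taftP x) (taftP y) => [{}x [{}y]].
by rewrite -taft_piZ pi_taftD !taft_mx_pi linearP.
Qed.
HB.instance Definition _ := GRing.isLinear.Build K H 'M[K]_m *:%R
  taft_mx taft_mx_linear.

Lemma taft_mx1 : taft_mx 1 = 1%:M.
Proof. by rewrite taft_mx_pi free_mx1. Qed.

Lemma taft_mxM x y : taft_mx (x * y) = taft_mx x *m taft_mx y.
Proof.
case: (taftP x) (taftP y) => [{}x [{}y]].
by rewrite -taft_piM !taft_mx_pi free_mxM.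
Qed.

Definition hmodule_of : hmodule := HModule taft_mx1 taft_mxM.

Lemma hmodule_of_g : act hmodule_of (taft_g n hq) = G.
Proof. by rewrite /= taft_mx_pi free_mxg. Qed.

Lemma hmodule_of_h : act hmodule_of (taft_h n hq) = X.
Proof. by rewrite /= taft_mx_pi free_mxh. Qed.
End Lift.

Section DirectSum.
Variables V W : hmodule.

Definition dsum_act (x : H) := block_mx (act V x) 0 0 (act W x).

Lemma dsum_act_linear : linear dsum_act.
Proof.
move=> a x y; rewrite /dsum_act !linearP scale_block_mx add_block_mx.
by rewrite !scaler0 !addr0.
Qed.
HB.instance Definition _ := GRing.isLinear.Build K H _ *:%R
  dsum_act dsum_act_linear.

Lemma dsum_act1 : dsum_act 1 = 1%:M.
Proof. by rewrite /dsum_act !act1 -scalar_mx_block. Qed.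

Lemma dsum_actM x y : dsum_act (x * y) = dsum_act x *m dsum_act y.
Proof.
by rewrite /dsum_act mulmx_block !actM !mul0mx !mulmx0 !addr0 !add0r.
Qed.

Definition dsum : hmodule := HModule dsum_act1 dsum_actM.
End DirectSum.

Section Tensor.
Variables V W : hmodule.
Local Notation gV := (act V (taft_g n hq)).
Local Notation hV := (act V (taft_h n hq)).
Local Notation gW := (act W (taft_g n hq)).
Local Notation hW := (act W (taft_h n hq)).

(* Delta(g) = g (x) g and Delta(h) = 1 (x) h + h (x) g, acting on V (x) W. *)
Definition tens_g := gV *t gW.
Definition tens_h := 1%:M *t hW + hV *t gW.

Lemma actX U x k : act U (x ^+ k) = (act U x : 'M[K]_(hdim U)) ^+ k.
Proof. by elim: k => [|k IH]; rewrite ?act1 // !exprS actM IH mulmxE. Qed.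

Lemma act_hg U : act U (taft_h n hq) *m act U (taft_g n hq) =
  q *: (act U (taft_g n hq) *m act U (taft_h n hq)).
Proof. by rewrite -!actM taft_hg linearZ. Qed.

Lemma tens_gn : tens_g ^+ n = 1 :> 'M[K]_(hdim V * hdim W).
Proof. by rewrite tensmxX -!actX taft_gn !act1 tensmx11. Qed.

Lemma tens_hd : tens_h ^+ d = 0 :> 'M[K]_(hdim V * hdim W).
Proof.
have AB : (1%:M *t hW) *m (hV *t gW) = q *: ((hV *t gW) *m (1%:M *t hW)).
  by rewrite !tensmx_mul mul1mx mulmx1 act_hg tensmxZr.
rewrite /tens_h (qbinomial AB) big1 // => i _.
have d_gt0 := prim_order_gt0 hq.
have [->|i_neq0] := eqVneq (i : nat) 0%N.
  by rewrite subn0 expr0 mulmxE mul1r tensmxX -(actX W) taft_hd linear0 tensmx0 scaler0.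
have [->|i_neqd] := eqVneq (i : nat) d.
  by rewrite tensmxX -(actX V) taft_hd linear0 tens0mx mul0mx scaler0.
by rewrite qbin_eq0 ?scale0r // lt0n i_neq0 ltn_neqAle i_neqd -ltnS ltn_ord.
Qed.

Lemma tens_hg : tens_h *m tens_g = q *: (tens_g *m tens_h).
Proof.
by apply: kron_comm; apply: act_hg.
Qed.

(* H acts on V (x) W through Delta. As Delta is an algebra morphism, this is the
   H-module on which g and h act by the images of Delta(g) and Delta(h). *)
Definition tens : hmodule := hmodule_of tens_gn tens_hd tens_hg.
End Tensor.

Lemma triv_hd : 0 ^+ d = 0 :> 'M[K]_1.
Proof. by rewrite expr0n -[d]prednK // (prim_order_gt0 hq). Qed.
Lemma triv_hg : (0 : 'M[K]_1) *m (1 : 'M[K]_1) = q *: ((1 : 'M[K]_1) *m (0 : 'M[K]_1)).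
Proof. by rewrite mul0mx mulmx0 scaler0. Qed.
(* K with action through the counit, eps(g) = 1 and eps(h) = 0. *)
Definition triv : hmodule :=
  @hmodule_of 1 1 0 (expr1n _ n) triv_hd triv_hg.

Lemma zero_gn : (0 : 'M[K]_0) ^+ n = 1.
Proof. by apply/matrixP => -[]. Qed.
Lemma zero_hd : (0 : 'M[K]_0) ^+ d = 0.
Proof. by apply/matrixP => -[]. Qed.
Lemma zero_hg : (0 : 'M[K]_0) *m (0 : 'M[K]_0) = q *: ((0 : 'M[K]_0) *m (0 : 'M[K]_0)).
Proof. by apply/matrixP => -[]. Qed.
Definition zero_hmodule : hmodule := hmodule_of zero_gn zero_hd zero_hg.

Definition is_submodule V (S : {pred 'cV[K]_(hdim V)}) : Prop :=
  submod_closed S /\ forall (x : H) v, v \in S -> act V x *m v \in S.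

Definition is_simple V : Prop :=
  (0 < hdim V)%N /\
  forall S, @is_submodule V S -> (forall v, v \in S -> v = 0) \/ (forall v, v \in S).

Definition is_semisimple V : Prop :=
  exists2 s : seq hmodule,
    (forall W, W \in s -> is_simple W) & isomorphic V (foldr dsum zero_hmodule s).

(* Lifting is only required along surjections of finite dimensional modules, the
   ambient category here. *)
Definition is_projective P : Prop :=
  forall V W (f : 'M[K]_(hdim W, hdim V)) (p : 'M[K]_(hdim W, hdim P)),
    is_hom f -> (forall w : 'cV[K]_(hdim W), exists v, f *m v = w) -> is_hom p ->
  exists2 s : 'M[K]_(hdim V, hdim P), is_hom s & f *m s = p.

Lemma is_hom_gen V W (f : 'M[K]_(hdim W, hdim V)) :
  f *m act V (taft_g n hq) = act W (taft_g n hq) *m f ->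
  f *m act V (taft_h n hq) = act W (taft_h n hq) *m f -> is_hom f.
Proof.
move=> fg fh; elim/taft_ind => [a x y Hx Hy|x y Hx Hy|||//].
- by rewrite !linearP /= mulmxDl -scalemxAl Hx Hy.
- by rewrite !actM mulmxA Hx -mulmxA Hy mulmxA.
- by rewrite !act1 mul1mx mulmx1.
- by [].
Qed.

Lemma isom_sym V W : isomorphic V W -> isomorphic W V.
Proof.
move=> [f [f' fH [ff' f'f]]]; exists f', f; last by split.
by move=> x; rewrite -[LHS]mulmx1 -ff' mulmxA -[_ *m f](mulmxA) -fH !mulmxA f'f mul1mx.
Qed.

Lemma isom_reindex V W (s : 'I_(hdim W) -> 'I_(hdim V)) (t : 'I_(hdim V) -> 'I_(hdim W)) :
  cancel s t -> cancel t s ->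
  (forall i j, act W (taft_g n hq) i j = act V (taft_g n hq) (s i) (s j)) ->
  (forall i j, act W (taft_h n hq) i j = act V (taft_h n hq) (s i) (s j)) ->
  isomorphic V W.
Proof.
move=> sK tK Eg Eh.
pose f : 'M[K]_(hdim W, hdim V) := \matrix_(i, j) (j == s i)%:R.
pose f' : 'M[K]_(hdim V, hdim W) := \matrix_(j, i) (j == s i)%:R.
have comm (A : 'M[K]_(hdim V)) (B : 'M[K]_(hdim W)) :
    (forall i j, B i j = A (s i) (s j)) -> f *m A = B *m f.
  move=> E; apply/matrixP => i j; rewrite !mxE.
  rewrite (bigD1 (s i)) //= mxE eqxx mul1r big1 ?addr0; last first.
    by move=> k /negPf nk; rewrite mxE nk mul0r.
  rewrite (bigD1 (t j)) //= mxE tK eqxx mulr1 big1 ?addr0; last first.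
    move=> k nk; rewrite mxE; case: eqP => [jE|_]; last by rewrite mulr0.
    by rewrite jE sK eqxx in nk.
  by rewrite E tK.
exists f, f'; first by apply: is_hom_gen; apply: comm.
split; apply/matrixP => i j; rewrite !mxE.
  rewrite (bigD1 (s i)) //= !mxE eqxx mul1r big1 ?addr0 ?(can_eq sK) //.
  by move=> k /negPf nk; rewrite mxE nk mul0r.
rewrite (bigD1 (t i)) //= !mxE tK eqxx mul1r big1 ?addr0 1?eq_sym //.
move=> k nk; rewrite mxE; case: eqP => [jE|_]; last by rewrite mul0r.
by rewrite jE sK eqxx in nk.
Qed.

Lemma tens_act_g V W : act (tens V W) (taft_g n hq) = tens_g V W.
Proof. exact: hmodule_of_g. Qed.
Lemma tens_act_h V W : act (tens V W) (taft_h n hq) = tens_h V W.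
Proof. exact: hmodule_of_h. Qed.

Lemma isom_tensl U V W : isomorphic V W -> isomorphic (tens V U) (tens W U).
Proof.
move=> [f [f' fH [ff' f'f]]].
exists (f *t 1%:M), (f' *t 1%:M); last by rewrite !tensmx_mul ff' f'f !mulmx1 !tensmx11.
apply: is_hom_gen; rewrite !(tens_act_g, tens_act_h).
  by rewrite !tensmx_mul fH mul1mx mulmx1.
by rewrite mulmxDl mulmxDr 4!tensmx_mul 2?fH !mul1mx !mulmx1.
Qed.

Lemma isom_tensr U V W : isomorphic V W -> isomorphic (tens U V) (tens U W).
Proof.
move=> [f [f' fH [ff' f'f]]].
exists (1%:M *t f), (1%:M *t f'); last by rewrite !tensmx_mul ff' f'f !mulmx1 !tensmx11.
apply: is_hom_gen; rewrite !(tens_act_g, tens_act_h).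
  by rewrite !tensmx_mul fH mul1mx mulmx1.
by rewrite mulmxDl mulmxDr 4!tensmx_mul 2?fH !mul1mx !mulmx1.
Qed.

End Modules.

Section KroneckerIndex.
Variable K : fieldType.
Local Notation ix := mxtens_index.
Local Notation un := mxtens_unindex.

Section Assoc.
Variables a b c : nat.

Definition assoc_ix (k : 'I_(a * b * c)) : 'I_(a * (b * c)) :=
  ix ((un (un k).1).1, ix ((un (un k).1).2, (un k).2)).
Definition assoc_xi (k : 'I_(a * (b * c))) : 'I_(a * b * c) :=
  ix (ix ((un k).1, (un (un k).2).1), (un (un k).2).2).

Lemma assoc_ixE i j k : assoc_ix (ix (ix (i, j), k)) = ix (i, ix (j, k)).
Proof. by rewrite /assoc_ix !mxtens_indexK. Qed.

Lemma assoc_ixK : cancel assoc_ix assoc_xi.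
Proof.
move=> l; case: (mxtens_indexP l) => ij k; case: (mxtens_indexP ij) => i j.
by rewrite assoc_ixE /assoc_xi !mxtens_indexK.
Qed.

Lemma assoc_xiK : cancel assoc_xi assoc_ix.
Proof.
move=> l; case: (mxtens_indexP l) => i jk; case: (mxtens_indexP jk) => j k.
by rewrite /assoc_xi !mxtens_indexK /= assoc_ixE.
Qed.

Lemma tensmxA_ix (A : 'M[K]_a) (B : 'M[K]_b) (C : 'M[K]_c) i j :
  (A *t B *t C) i j = (A *t (B *t C)) (assoc_ix i) (assoc_ix j).
Proof.
case: (mxtens_indexP i) => i1 i2; case: (mxtens_indexP i1) => {}i1 i3.
case: (mxtens_indexP j) => j1 j2; case: (mxtens_indexP j1) => {}j1 j3.
by rewrite !assoc_ixE !tensmxE mulrA.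
Qed.
End Assoc.

Lemma tens1mx_ix a (A : 'M[K]_a) i j :
  A i j = ((1 : 'M_1) *t A) (ix (0, i)) (ix (0, j)).
Proof. by rewrite tensmxE mxE mul1r. Qed.

Lemma tensmx1_ix a (A : 'M[K]_a) i j :
  A i j = (A *t (1 : 'M_1)) (ix (i, 0)) (ix (j, 0)).
Proof. by rewrite tensmxE [X in _ * X]mxE mulr1. Qed.

Section Distr.
Variables a b c : nat.

Definition distl_ix (k : 'I_(a * c + b * c)) : 'I_((a + b) * c) :=
  match split k with
  | inl i => ix (lshift b (un i).1, (un i).2)
  | inr j => ix (rshift a (un j).1, (un j).2)
  end.
Definition distl_xi (k : 'I_((a + b) * c)) : 'I_(a * c + b * c) :=
  match split (un k).1 with
  | inl i => lshift _ (ix (i, (un k).2))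
  | inr j => rshift _ (ix (j, (un k).2))
  end.

Lemma distl_ixl i k : distl_ix (lshift _ (ix (i, k))) = ix (lshift _ i, k).
Proof. by rewrite /distl_ix (unsplitK (inl _)) mxtens_indexK. Qed.
Lemma distl_ixr j k : distl_ix (rshift _ (ix (j, k))) = ix (rshift _ j, k).
Proof. by rewrite /distl_ix (unsplitK (inr _)) mxtens_indexK. Qed.
Lemma distl_xil i k : distl_xi (ix (lshift _ i, k)) = lshift _ (ix (i, k)).
Proof. by rewrite /distl_xi mxtens_indexK (unsplitK (inl _)). Qed.
Lemma distl_xir j k : distl_xi (ix (rshift _ j, k)) = rshift _ (ix (j, k)).
Proof. by rewrite /distl_xi mxtens_indexK (unsplitK (inr _)). Qed.

Lemma distl_ixK : cancel distl_ix distl_xi.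
Proof.
move=> l; case: (split_ordP l) => k ->; case: (mxtens_indexP k) => {}k i.
  by rewrite distl_ixl distl_xil.
by rewrite distl_ixr distl_xir.
Qed.

Lemma distl_xiK : cancel distl_xi distl_ix.
Proof.
move=> l; case: (mxtens_indexP l) => k i; case: (split_ordP k) => {}k ->.
  by rewrite distl_xil distl_ixl.
by rewrite distl_xir distl_ixr.
Qed.

Lemma tensmxDl_ix (A : 'M[K]_a) (B : 'M[K]_b) (C : 'M[K]_c) i j :
  (block_mx (A *t C) 0 0 (B *t C)) i j =
  (block_mx A 0 0 B *t C) (distl_ix i) (distl_ix j).
Proof.
case: (split_ordP i) => i1 ->; case: (mxtens_indexP i1) => {}i1 i2;
case: (split_ordP j) => j1 ->; case: (mxtens_indexP j1) => {}j1 j2.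
- by rewrite !distl_ixl block_mxEul !tensmxE block_mxEul.
- by rewrite distl_ixl distl_ixr block_mxEur !tensmxE block_mxEur !mxE mul0r.
- by rewrite distl_ixl distl_ixr block_mxEdl !tensmxE block_mxEdl !mxE mul0r.
- by rewrite !distl_ixr block_mxEdr !tensmxE block_mxEdr.
Qed.

Definition distr_ix (k : 'I_(c * a + c * b)) : 'I_(c * (a + b)) :=
  match split k with
  | inl i => ix ((un i).1, lshift b (un i).2)
  | inr j => ix ((un j).1, rshift a (un j).2)
  end.
Definition distr_xi (k : 'I_(c * (a + b))) : 'I_(c * a + c * b) :=
  match split (un k).2 with
  | inl i => lshift _ (ix ((un k).1, i))
  | inr j => rshift _ (ix ((un k).1, j))
  end.

Lemma distr_ixl i k : distr_ix (lshift _ (ix (k, i))) = ix (k, lshift _ i).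
Proof. by rewrite /distr_ix (unsplitK (inl _)) mxtens_indexK. Qed.
Lemma distr_ixr j k : distr_ix (rshift _ (ix (k, j))) = ix (k, rshift _ j).
Proof. by rewrite /distr_ix (unsplitK (inr _)) mxtens_indexK. Qed.
Lemma distr_xil i k : distr_xi (ix (k, lshift _ i)) = lshift _ (ix (k, i)).
Proof. by rewrite /distr_xi mxtens_indexK (unsplitK (inl _)). Qed.
Lemma distr_xir j k : distr_xi (ix (k, rshift _ j)) = rshift _ (ix (k, j)).
Proof. by rewrite /distr_xi mxtens_indexK (unsplitK (inr _)). Qed.

Lemma distr_ixK : cancel distr_ix distr_xi.
Proof.
move=> l; case: (split_ordP l) => k ->; case: (mxtens_indexP k) => {}k i.
  by rewrite distr_ixl distr_xil.
by rewrite distr_ixr distr_xir.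
Qed.

Lemma distr_xiK : cancel distr_xi distr_ix.
Proof.
move=> l; case: (mxtens_indexP l) => i k; case: (split_ordP k) => {}k ->.
  by rewrite distr_xil distr_ixl.
by rewrite distr_xir distr_ixr.
Qed.

Lemma tensmxDr_ix (A : 'M[K]_a) (B : 'M[K]_b) (C : 'M[K]_c) i j :
  (block_mx (C *t A) 0 0 (C *t B)) i j =
  (C *t block_mx A 0 0 B) (distr_ix i) (distr_ix j).
Proof.
case: (split_ordP i) => i1 ->; case: (mxtens_indexP i1) => {}i1 i2;
case: (split_ordP j) => j1 ->; case: (mxtens_indexP j1) => {}j1 j2.
- by rewrite !distr_ixl block_mxEul !tensmxE block_mxEul.
- by rewrite distr_ixl distr_ixr block_mxEur !tensmxE block_mxEur !mxE mulr0.
- by rewrite distr_ixl distr_ixr block_mxEdl !tensmxE block_mxEdl !mxE mulr0.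
- by rewrite !distr_ixr block_mxEdr !tensmxE block_mxEdr.
Qed.
End Distr.

Lemma hA_ix a b c (X1 : 'M[K]_a) (X2 G2 : 'M[K]_b) (X3 G3 : 'M[K]_c) i j :
  (1%:M *t X3 + (1%:M *t X2 + X1 *t G2) *t G3) i j =
  (1%:M *t (1%:M *t X3 + X2 *t G3) + X1 *t (G2 *t G3)) (assoc_ix i) (assoc_ix j).
Proof.
rewrite tensmxDl tensmxDr -(@tensmx11 K a b).
rewrite !addmxE.
by rewrite !tensmxA_ix addrA.
Qed.

Lemma hDl_ix a b c (X1 : 'M[K]_a) (X2 : 'M[K]_b) (X G : 'M[K]_c) i j :
  (block_mx (1%:M *t X + X1 *t G) 0 0 (1%:M *t X + X2 *t G)) i j =
  (1%:M *t X + block_mx X1 0 0 X2 *t G) (distl_ix i) (distl_ix j).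
Proof.
rewrite [in RHS]addmxE (scalar_mx_block a b) -!tensmxDl_ix -addmxE.
by rewrite add_block_mx !addr0.
Qed.

Lemma hDr_ix a b c (X1 G1 : 'M[K]_a) (X2 G2 : 'M[K]_b) (X : 'M[K]_c) i j :
  (block_mx (1%:M *t X1 + X *t G1) 0 0 (1%:M *t X2 + X *t G2)) i j =
  (1%:M *t block_mx X1 0 0 X2 + X *t block_mx G1 0 0 G2) (distr_ix i) (distr_ix j).
Proof.
rewrite [in RHS]addmxE -!tensmxDr_ix -addmxE.
by rewrite add_block_mx !addr0.
Qed.

End KroneckerIndex.

Section TensorIsos.
Variables (K : fieldType) (n d : nat) (q : K) (hq : d.-primitive_root q).
Implicit Types V W U : hmodule n hq.

Lemma isom_refl V : isomorphic V V.
Proof.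
by exists 1%:M, 1%:M; [move=> x; rewrite mul1mx mulmx1 | rewrite !mulmx1].
Qed.

Lemma isom_tensA U V W : isomorphic (tens U (tens V W)) (tens (tens U V) W).
Proof.
apply: (isom_reindex (V := tens U (tens V W)) (W := tens (tens U V) W)
  (@assoc_ixK _ _ _) (@assoc_xiK _ _ _)) => i j.
  by rewrite 2!tens_act_g /tens_g 2!tens_act_g; apply: tensmxA_ix.
by rewrite 2!tens_act_h /tens_h tens_act_g 2!tens_act_h; apply: hA_ix.
Qed.

Lemma isom_tens1 V : isomorphic (tens (triv n hq) V) V.
Proof.
apply: (isom_reindex (V := tens (triv n hq) V) (W := V)
  (s := fun k => mxtens_index (0 : 'I_1, k)) (t := fun k => (mxtens_unindex k).2)).
- by move=> k; rewrite mxtens_indexK.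
- by move=> k; case: (mxtens_indexP k) => a b; rewrite mxtens_indexK [a]ord1.
- by move=> i j; rewrite tens_act_g /tens_g hmodule_of_g; apply: tens1mx_ix.
- move=> i j; rewrite tens_act_h /tens_h hmodule_of_h tens0mx addr0.
  exact: tens1mx_ix.
Qed.

Lemma isom_tensr1 V : isomorphic (tens V (triv n hq)) V.
Proof.
apply: (isom_reindex (V := tens V (triv n hq)) (W := V)
  (s := fun k => mxtens_index (k, 0 : 'I_1)) (t := fun k => (mxtens_unindex k).1)).
- by move=> k; rewrite mxtens_indexK.
- by move=> k; case: (mxtens_indexP k) => a b; rewrite mxtens_indexK [b]ord1.
- by move=> i j; rewrite tens_act_g /tens_g hmodule_of_g; apply: tensmx1_ix.
- move=> i j; rewrite tens_act_h /tens_h hmodule_of_g hmodule_of_h tensmx0 add0r.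
  exact: tensmx1_ix.
Qed.

Lemma isom_tensDl U V W :
  isomorphic (tens (dsum V W) U) (dsum (tens V U) (tens W U)).
Proof.
apply: (isom_reindex (V := tens (dsum V W) U) (W := dsum (tens V U) (tens W U))
  (@distl_ixK _ _ _) (@distl_xiK _ _ _)) => i j.
  rewrite tens_act_g /= /dsum_act -!/(act (tens _ _) _) 2!tens_act_g.
  exact: tensmxDl_ix.
rewrite tens_act_h /= /dsum_act -!/(act (tens _ _) _) 2!tens_act_h.
exact: hDl_ix.
Qed.

Lemma isom_tensDr U V W :
  isomorphic (tens U (dsum V W)) (dsum (tens U V) (tens U W)).
Proof.
apply: (isom_reindex (V := tens U (dsum V W)) (W := dsum (tens U V) (tens U W))
  (@distr_ixK _ _ _) (@distr_xiK _ _ _)) => i j.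
  rewrite tens_act_g /= /dsum_act -!/(act (tens _ _) _) 2!tens_act_g.
  exact: tensmxDr_ix.
rewrite tens_act_h /= /dsum_act -!/(act (tens _ _) _) 2!tens_act_h.
exact: hDr_ix.
Qed.

End TensorIsos.

Section GreenGroup.
Variables (K : fieldType) (n d : nat) (q : K) (hq : d.-primitive_root q).
Implicit Types V W U : hmodule n hq.
Local Notation F := {malg int[hmodule n hq]}.

(* The free group is on modules rather than on isomorphism classes, hence the
   relations [V] = [W] for isomorphic V and W. *)
Inductive in_green_rel : F -> Prop :=
| green_rel_isom V W : isomorphic V W -> in_green_rel (<< V >> - << W >>)
| green_rel_dsum V W : in_green_rel (<< dsum V W >> - (<< V >> + << W >>))
| green_rel0 : in_green_rel 0
| green_relB x y : in_green_rel x -> in_green_rel y -> in_green_rel (x - y).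

Definition green_rel : {pred F} := fun x => `[< in_green_rel x >].

Lemma green_rel_zmod_closed : zmod_closed green_rel.
Proof.
split=> [|x y /asboolP Ix /asboolP Iy]; first exact/asboolP/green_rel0.
exact/asboolP/green_relB.
Qed.
HB.instance Definition _ := GRing.isZmodClosed.Build F green_rel green_rel_zmod_closed.

Definition green : Type := Quotient.quot green_rel.
HB.instance Definition _ := GRing.Zmodule.on green.
HB.instance Definition _ := Quotient.on green.

Definition green_pi (x : F) : green := \pi x.
Definition cls V : green := green_pi << V >>.

Lemma green_piP x y : reflect (green_pi x = green_pi y) (x - y \in green_rel).
Proof. by rewrite /green_pi Quotient.idealrBE; apply: eqP. Qed.

Lemma green_pi_zmod : zmod_morphism green_pi.
Proof. by move=> x y; rewrite /green_pi raddfB. Qed.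
HB.instance Definition _ := GRing.isZmodMorphism.Build F green green_pi green_pi_zmod.

Lemma cls_isom V W : isomorphic V W -> cls V = cls W.
Proof. by move=> VW; apply/green_piP/asboolP/green_rel_isom. Qed.

Lemma cls_dsum V W : cls (dsum V W) = cls V + cls W.
Proof.
by rewrite /cls -raddfD; apply/green_piP/asboolP/green_rel_dsum.
Qed.

Lemma green_ind (P : green -> Prop) :
  P 0 -> (forall x y, P x -> P y -> P (x - y)) -> (forall V, P (cls V)) ->
  forall x, P x.
Proof.
move=> P0 PB Pc x; rewrite -[x]reprK -/(green_pi _) [repr x]monalgE raddf_sum.
have PN y : P y -> P (- y) by move=> Py; rewrite -sub0r; apply: PB.
have PD y z : P y -> P z -> P (y + z).
  by move=> Py Pz; rewrite -[z]opprK; apply/PB/PN.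
elim/big_ind: _ => // V _ /=; set c := _@__.
have -> : green_pi << c *g V >> = cls V *~ c.
  rewrite /cls -raddfMz; congr green_pi; apply/malgP => W.
  by rewrite raddfMz /= !mcoeffU; case: eqP; rewrite ?mulr1n ?mulr0n ?intz ?mul0rz.
have PM k : P (cls V *+ k).
  by elim: k => [|k IH]; rewrite ?mulr0n // mulrS; apply: PD.
by case: c => k; [apply: PM | apply/PN/PM].
Qed.

Section Lift.
Variables (A : zmodType) (f : hmodule n hq -> A).

Definition free_lift (x : F) : A := \sum_(V <- msupp x) f V *~ x@_V.

Lemma free_liftEw (D : {fset hmodule n hq}) x : (msupp x `<=` D)%fset ->
  free_lift x = \sum_(V <- D) f V *~ x@_V.
Proof.
move=> le; rewrite /free_lift (big_fset_incl _ le) // => V _ /mcoeff_outdom ->.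
by rewrite mulr0z.
Qed.

Lemma free_lift_zmod : zmod_morphism free_lift.
Proof.
move=> x y; set D := (msupp x `|` msupp y)%fset.
rewrite !(@free_liftEw D) ?fsubsetUl ?fsubsetUr ?msuppB_le //.
by rewrite -sumrB; apply: eq_bigr => V _; rewrite mcoeffB mulrzBr.
Qed.
HB.instance Definition _ := GRing.isZmodMorphism.Build F A free_lift free_lift_zmod.

Lemma free_liftU V : free_lift << V >> = f V.
Proof.
rewrite (@free_liftEw [fset V]%fset) ?msuppU_le // big_seq_fset1.
by rewrite mcoeffU eqxx mulr1z.
Qed.

Definition green_lift (x : green) : A := free_lift (repr x).

Hypothesis f_isom : forall V W, isomorphic V W -> f V = f W.
Hypothesis f_dsum : forall V W, f (dsum V W) = f V + f W.

Lemma free_lift_rel x : x \in green_rel -> free_lift x = 0.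
Proof.
move/asboolP; elim=> [V W VW|V W||y z _ Hy _ Hz].
- by rewrite raddfB /= !free_liftU (f_isom VW) subrr.
- by rewrite raddfB raddfD /= !free_liftU f_dsum subrr.
- exact: raddf0.
- by rewrite raddfB /= Hy Hz subrr.
Qed.

Lemma green_lift_pi x : green_lift (green_pi x) = free_lift x.
Proof.
apply/eqP; rewrite -subr_eq0 -raddfB; apply/eqP/free_lift_rel/green_piP.
by rewrite /green_pi reprK.
Qed.

Lemma green_liftB : zmod_morphism green_lift.
Proof.
move=> x y; rewrite -[x]reprK -[y]reprK -!/(green_pi _) -raddfB.
by rewrite !green_lift_pi raddfB.
Qed.

Lemma green_lift_cls V : green_lift (cls V) = f V.
Proof. by rewrite green_lift_pi free_liftU. Qed.
End Lift.

(* [V][W] = [V (x) W], extended biadditively. *)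
Definition green_mull V : green -> green := green_lift (fun W => cls (tens V W)).
Definition green_mul (x y : green) : green := green_lift (green_mull^~ y) x.
Definition green_one : green := cls (triv n hq).

Lemma green_mull_cls V W : green_mull V (cls W) = cls (tens V W).
Proof.
apply: (green_lift_cls (f := fun W => cls (tens V W))) => [W1 W2 iW|W1 W2].
  exact/cls_isom/isom_tensr.
by rewrite -cls_dsum; apply/cls_isom/isom_tensDr.
Qed.

Lemma green_mullB V : zmod_morphism (green_mull V).
Proof.
apply: green_liftB => [W1 W2 iW|W1 W2].
  exact/cls_isom/isom_tensr.
by rewrite -cls_dsum; apply/cls_isom/isom_tensDr.
Qed.
HB.instance Definition _ V := GRing.isZmodMorphism.Build green green
  (green_mull V) (green_mullB V).

Lemma green_mull_isom y V W : isomorphic V W -> green_mull V y = green_mull W y.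
Proof.
move=> VW; elim/green_ind: y => [|x y Hx Hy|U].
- by rewrite !raddf0.
- by rewrite !raddfB /= Hx Hy.
- by rewrite !green_mull_cls; apply/cls_isom/isom_tensl.
Qed.

Lemma green_mull_dsum y V W :
  green_mull (dsum V W) y = green_mull V y + green_mull W y.
Proof.
elim/green_ind: y => [|x y Hx Hy|U].
- by rewrite !raddf0 addr0.
- by rewrite !raddfB /= Hx Hy opprD addrACA.
- by rewrite !green_mull_cls -cls_dsum; apply/cls_isom/isom_tensDl.
Qed.

Lemma green_mul_clsl V y : green_mul (cls V) y = green_mull V y.
Proof.
apply: (green_lift_cls (f := green_mull^~ y)).
  exact: green_mull_isom.
exact: green_mull_dsum.
Qed.

Lemma green_mulBl y : zmod_morphism (green_mul^~ y).
Proof.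
apply: green_liftB; first exact: green_mull_isom.
exact: green_mull_dsum.
Qed.

Lemma green_mul0 x : green_mul 0 x = 0.
Proof. by have := green_mulBl x 0 0; rewrite /= !subrr. Qed.

Lemma green_mulBr x : zmod_morphism (green_mul x).
Proof.
move=> y z; elim/green_ind: x => [|x x' Hx Hx'|V].
- by rewrite !green_mul0 subr0.
- by rewrite !green_mulBl Hx Hx' !opprD !opprK addrACA.
- by rewrite !green_mul_clsl raddfB.
Qed.

Lemma zmod_morphD (A B : zmodType) (f : A -> B) :
  zmod_morphism f -> {morph f : x y / x + y}.
Proof.
move=> fB x y; have f0 : f 0 = 0 by rewrite -(subrr 0) fB subrr.
by rewrite -[y in LHS]opprK fB -[- y]sub0r fB f0 sub0r opprK.
Qed.

Lemma green_mulDl : left_distributive green_mul +%R.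
Proof. by move=> x y z; apply: (zmod_morphD (green_mulBl z)). Qed.
Lemma green_mulDr : right_distributive green_mul +%R.
Proof. by move=> x y z; apply: (zmod_morphD (green_mulBr x)). Qed.

Lemma green_mul_cls V W : green_mul (cls V) (cls W) = cls (tens V W).
Proof. by rewrite green_mul_clsl green_mull_cls. Qed.

Lemma green_mulr0 x : green_mul x 0 = 0.
Proof. by have := green_mulBr x 0 0; rewrite !subrr. Qed.

Lemma green_mulA : associative green_mul.
Proof.
move=> x y z; elim/green_ind: x => [|x x' Hx Hx'|U]; first by rewrite !green_mul0.
  by rewrite !green_mulBl Hx Hx'.
elim/green_ind: y => [|y y' Hy Hy'|V]; first by rewrite !(green_mul0, green_mulr0).
  by rewrite !(green_mulBl, green_mulBr) Hy Hy'.
elim/green_ind: z => [|z z' Hz Hz'|W]; first by rewrite !green_mulr0.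
  by rewrite !green_mulBr Hz Hz'.
by rewrite !green_mul_cls; apply/cls_isom/isom_tensA.
Qed.

Lemma green_mul1 : left_id green_one green_mul.
Proof.
elim/green_ind => [|x y Hx Hy|V]; first by rewrite green_mulr0.
  by rewrite green_mulBr Hx Hy.
by rewrite green_mul_cls; apply/cls_isom/isom_tens1.
Qed.

Lemma green_mulr1 : right_id green_one green_mul.
Proof.
elim/green_ind => [|x y Hx Hy|V]; first by rewrite green_mul0.
  by rewrite green_mulBl Hx Hy.
by rewrite green_mul_cls; apply/cls_isom/isom_tensr1.
Qed.

Lemma green_one_neq0 : green_one != 0.
Proof.
pose dimz V : int := (hdim V)%:Z.
have dim_isom V W : isomorphic V W -> dimz V = dimz W.
  move=> [f [f' _ [ff' f'f]]]; congr Posz; apply/eqP; rewrite eqn_leq.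
  have le a b (u : 'M[K]_(a, b)) (v : 'M[K]_(b, a)) : u *m v = 1%:M -> (a <= b)%N.
    by move=> uv; rewrite -(mxrank1 K a) -uv (leq_trans (mxrankM_maxl _ _)) ?rank_leq_col.
  by rewrite (le _ _ _ _ ff') (le _ _ _ _ f'f).
have dim_dsum V W : dimz (dsum V W) = dimz V + dimz W by [].
apply/eqP => /(congr1 (green_lift dimz)).
rewrite green_lift_cls // -(subrr green_one) (green_liftB dim_isom dim_dsum) subrr.
by [].
Qed.

HB.instance Definition _ := GRing.Zmodule_isNzRing.Build green
  green_mulA green_mul1 green_mulr1 green_mulDl green_mulDr green_one_neq0.

Lemma clsM V W : cls V * cls W = cls (tens V W).
Proof. exact: green_mul_cls. Qed.

Definition proj_class_ring : {pred green} := fun x =>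
  `[< forall S : {pred green}, subring_closed S ->
        (forall V, is_projective V \/ is_semisimple V -> cls V \in S) -> x \in S >].

Lemma proj_class_ring_closed : subring_closed proj_class_ring.
Proof.
split=> [|x y /asboolP px /asboolP py|x y /asboolP px /asboolP py];
  apply/asboolP => S Sring Scls; have [S1 SB SM] := Sring.
- exact: S1.
- exact: SB (px S Sring Scls) (py S Sring Scls).
- exact: SM (px S Sring Scls) (py S Sring Scls).
Qed.
HB.instance Definition _ :=
  GRing.isSubringClosed.Build green proj_class_ring proj_class_ring_closed.

Record pcring := PCRing { pcring_val : green; _ : pcring_val \in proj_class_ring }.
HB.instance Definition _ := [isSub for pcring_val].
HB.instance Definition _ := [Choice of pcring by <:].
HB.instance Definition _ := [SubChoice_isSubNzRing of pcring by <:].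

End GreenGroup.
Arguments pcring_val {K n d q hq} _.

Definition nilpotents (R : nzRingType) : set R := [set x | exists k, x ^+ k = 0].
Arguments nilpotents R : clear implicits.

(* Main.v *)
From HB Require Import structures.
Require Import Defs.
From mathcomp Require Import all_boot all_order all_algebra.
From mathcomp Require Import cyclic separable cyclotomic.
From mathcomp Require Import boolp classical_sets.
From mathcomp.real_closed Require Import mxtens.

(* Every module is a direct sum of uniserial modules M(l, r), 1 <= l <= d, whose
   multiplicities are read off the ranks of the elements h^j e_s of H_{n,d}, where e_s
   is the idempotent of the eigenvalue w^s of g, w a primitive n-th root of unity.
   Tensoring with M(1, 1) shifts r, and tensoring with M(2, 0) sends M(l, r) to
   M(l+1, r) + M(l-1, r+c) for l < d and M(d, r) to M(d, r) + M(d, r+c), where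
   w^c = q^-1; hence these two classes generate the Green ring.  Modulo the projective
   modules M(d, r), they act on the remaining M(l, r) by integer matrices Y and Z with
   Y^T = Y^-1 and Z^T = Y^-c Z, so that Y, Z and their transposes commute and every
   element of the Green ring acts by a normal matrix.  A nilpotent normal matrix is 0,
   so a nilpotent element is a combination of the projective classes [M(d, r)]. *)

Set Implicit Arguments.
Unset Strict Implicit.
Unset Printing Implicit Defensive.

Import Order.TTheory GRing.Theory Num.Theory.
Local Open Scope ring_scope.

(** * Nilpotent normal matrices over an ordered domain *)

Section NormalMatrices.
Variable R : realDomainType.

(** The diagonal of [A^T *m A] consists of sums of squares, which vanish only termwise. *)
Lemma mulTmx_eq0 m k (A : 'M[R]_(m, k)) : A^T *m A = 0 -> A = 0.
Proof.
move/matrixP => AA; apply/matrixP => i j; rewrite mxE.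
have := AA j j; rewrite !mxE.
under eq_bigr do rewrite mxE -expr2.
by move/psumr_eq0P => /(_ (fun i _ => sqr_ge0 _) i isT)/eqP; rewrite sqrf_eq0 => /eqP.
Qed.

(** [A ^+ k.+1] is symmetric with square [A ^+ k * A ^+ k.+2], so the exponent can be lowered step
    by step to 1. *)
Lemma sym_nilp_mx m (A : 'M[R]_m) k : A^T = A -> A ^+ k = 0 -> A = 0.
Proof.
move=> symA; elim: k => [|[|k] IH] Ak; last apply: IH.
- by rewrite -[A]mulr1 -(expr0 A) Ak mulr0.
- by rewrite -[A]expr1.
apply: mulTmx_eq0.
have -> : (A ^+ k.+1)^T = A ^+ k.+1.
  elim: k.+1 => [|e IHe]; first by rewrite expr0 trmx1.
  by rewrite exprS -[A * _]/(A *m _) trmx_mul symA IHe [in LHS]mulmxE -exprSr exprS.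
by rewrite mulmxE -exprD addSnnS exprD Ak mulr0.
Qed.

(** By normality the symmetric matrix [A^T *m A] is nilpotent too. *)
Lemma normal_nilp_mx m (A : 'M[R]_m) k :
  A^T *m A = A *m A^T -> A ^+ k = 0 -> A = 0.
Proof.
move=> nA Ak; apply/mulTmx_eq0/(@sym_nilp_mx _ _ k).
  by rewrite trmx_mul trmxK.
by rewrite mulmxE exprMn_comm // Ak mulr0.
Qed.

End NormalMatrices.

(** * Double commutants *)

Section Bicommutant.
Variables (R : comPzRingType) (m : nat) (P : 'M[R]_m -> Prop).

(** Stands in for the algebra generated by [P]: it contains [P], is closed under differences and
    products, and suffices for normality. *)
Definition bicommutant (A : 'M[R]_m) : Prop :=
  forall C, (forall B, P B -> C *m B = B *m C) -> A *m C = C *m A.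

Lemma bicommutant_gen B : P B -> bicommutant B.
Proof. by move=> PB C CP; rewrite CP. Qed.

Lemma bicommutant1 : bicommutant 1%:M.
Proof. by move=> C _; rewrite mul1mx mulmx1. Qed.

Lemma bicommutantB A B : bicommutant A -> bicommutant B -> bicommutant (A - B).
Proof. by move=> hA hB C CP; rewrite mulmxBl mulmxBr hA ?hB. Qed.

Lemma bicommutantM A B : bicommutant A -> bicommutant B -> bicommutant (A *m B).
Proof. by move=> hA hB C CP; rewrite -mulmxA hB // mulmxA hA // mulmxA. Qed.

(** [A] commutes with each [B^T]; transposing, [A^T] commutes with all of [P], hence with [A]. *)
Lemma bicommutant_normal A :
  (forall B, P B -> P B^T) ->
  (forall B B', P B -> P B' -> B *m B' = B' *m B) ->
  bicommutant A -> A^T *m A = A *m A^T.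
Proof.
move=> PT Pcomm hA; rewrite [RHS]hA // => B PB.
apply: trmx_inj; rewrite !trmx_mul trmxK hA // => B' PB'.
exact/Pcomm/PB'/PT.
Qed.

End Bicommutant.

Lemma sum_unity_root (K : fieldType) n (x : K) :
  x ^+ n = 1 -> \sum_(i < n) x ^+ i = if x == 1 then n%:R else 0.
Proof.
move=> xn; case: eqP => [->|/eqP x1].
  by under eq_bigr do rewrite expr1n; rewrite sumr_const card_ord.
by apply: (mulfI (x := x - 1)); rewrite ?subr_eq0 // -subrX1 xn subrr mulr0.
Qed.

(** * Ranks and direct summands of modules *)

Section HModules.
Variables (K : fieldType) (n d : nat) (q : K) (hq : d.-primitive_root q).
Local Notation hmod := (hmodule n hq).
Local Notation g := (taft_g n hq).
Local Notation h := (taft_h n hq).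
Implicit Types V W : hmod.

Lemma actZ V a x : act V (a *: x) = a *: act V x.
Proof. exact: linearZ. Qed.

Lemma act_sum V I (r : seq I) (P : pred I) (F : I -> taft n hq) :
  act V (\sum_(i <- r | P i) F i) = \sum_(i <- r | P i) act V (F i).
Proof. exact: linear_sum. Qed.

Lemma act_hXg V j :
  act V (h ^+ j) *m act V g = q ^+ j *: (act V g *m act V (h ^+ j)).
Proof.
have := act_hg V; elim: j => [|j IH] hg.
  by rewrite !expr0 act1 mul1mx mulmx1 scale1r.
by rewrite exprS actM -mulmxA IH // -scalemxAr [in LHS]mulmxA hg -scalemxAl scalerA
  -exprSr mulmxA.
Qed.

Lemma act_hX_ge V j : (d <= j)%N -> act V (h ^+ j) = 0.
Proof. by move=> le_dj; rewrite -(subnK le_dj) exprD taft_hd mulr0 linear0. Qed.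

Lemma isom_hdim V W : isomorphic V W -> hdim V = hdim W.
Proof.
move=> [f [f' _ [ff' f'f]]]; apply/eqP; rewrite eqn_leq.
have le a b (u : 'M[K]_(a, b)) (v : 'M[K]_(b, a)) : u *m v = 1%:M -> (a <= b)%N.
  by move=> uv; rewrite -(mxrank1 K a) -uv (leq_trans (mxrankM_maxl _ _)) ?rank_leq_col.
by rewrite (le _ _ _ _ ff') (le _ _ _ _ f'f).
Qed.

(** Together with [rank_act_dsum], this lets each element of the algebra define an integer function
    on the Green group. *)
Lemma rank_act_isom (x : taft n hq) V W :
  isomorphic V W -> \rank (act V x) = \rank (act W x).
Proof.
have le U U' : isomorphic U U' -> (\rank (act U x) <= \rank (act U' x))%N.
  move=> [f [f' fH [ff' f'f]]].
  have -> : act U x = f' *m act U' x *m f by rewrite -mulmxA -fH mulmxA f'f mul1mx.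
  by rewrite (leq_trans (mxrankM_maxl _ _)) ?mxrankM_maxr.
by move=> VW; apply/eqP; rewrite eqn_leq !le //; apply: isom_sym.
Qed.

Lemma rank_act_dsum (x : taft n hq) V W :
  \rank (act (dsum V W) x) = (\rank (act V x) + \rank (act W x))%N.
Proof. exact: rank_diag_block_mx. Qed.

Section Compression.
Variables (V : hmod) (r : nat) (A : 'M[K]_(hdim V, r)) (B : 'M[K]_(r, hdim V)).
Hypotheses (BA : B *m A = 1%:M)
  (ABH : forall x, A *m B *m act V x = act V x *m (A *m B)).

(** [A *m B] is an equivariant idempotent of [V]; this is the action on its image. *)
Definition compr_act x := B *m act V x *m A.

Lemma compr_act_linear : linear compr_act.
Proof.
by move=> a x y; rewrite /compr_act linearP mulmxDr mulmxDl -scalemxAr -scalemxAl.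
Qed.
HB.instance Definition _ := GRing.isLinear.Build K (taft n hq) 'M[K]_r *:%R
  compr_act compr_act_linear.

Lemma compr_act1 : compr_act 1 = 1%:M.
Proof. by rewrite /compr_act act1 mulmx1. Qed.

Lemma compr_actM x y : compr_act (x * y) = compr_act x *m compr_act y.
Proof.
rewrite /compr_act -!mulmxA [A *m (B *m _)]mulmxA [A *m B *m _]mulmxA ABH actM.
by rewrite -!mulmxA BA mulmx1.
Qed.

Definition compr : hmod := HModule compr_act1 compr_actM.
End Compression.

(** In a rank factorization [e = A *m B], the outer factors cancel from
    [A *m B *m A *m B = A *m B]. *)
Lemma idem_factor m (e : 'M[K]_m) : e *m e = e ->
  exists r (A : 'M_(m, r)) (B : 'M_(r, m)), A *m B = e /\ B *m A = 1%:M.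
Proof.
have := mulmx_base e; have := col_base_full e; have := row_base_free e.
move: (\rank e) (col_base e) (row_base e) => r A B /row_freeP[B' BB'].
move=> /row_fullP[A' A'A] <- ABAB; exists r, A, B; split=> //.
have := congr1 (fun X => A' *m (X *m B')) ABAB.
by rewrite !mulmxA A'A mul1mx -!mulmxA BB' !mulmx1.
Qed.

(** The complement is the image of the equivariant idempotent [1%:M - i *m p]. *)
Lemma split_dsum V M (i : 'M[K]_(hdim V, hdim M)) (p : 'M[K]_(hdim M, hdim V)) :
  is_hom i -> is_hom p -> p *m i = 1%:M ->
  exists W : hmod, isomorphic V (dsum M W).
Proof.
move=> iH pH pi1; pose e := 1%:M - i *m p.
have pe : p *m e = 0 by rewrite mulmxBr mulmx1 mulmxA pi1 mul1mx subrr.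
have ei : e *m i = 0 by rewrite mulmxBl mul1mx -mulmxA pi1 mulmx1 subrr.
have ee : e *m e = e by rewrite mulmxBl mul1mx -mulmxA pe mulmx0 subr0.
have eH x : e *m act V x = act V x *m e.
  by rewrite mulmxBl mulmxBr mul1mx mulmx1 -mulmxA pH mulmxA iH mulmxA.
have [r [A [B [AB BA]]]] := idem_factor ee.
have ABH x : A *m B *m act V x = act V x *m (A *m B) by rewrite AB eH.
exists (compr BA ABH), (col_mx p B), (row_mx i A); last split.
- move=> x /=; rewrite mul_col_mx /dsum_act mul_block_col !mul0mx addr0 add0r.
  rewrite pH /= /compr_act -[_ *m A *m B]mulmxA -[B *m _ *m _]mulmxA -ABH.
  by rewrite -mulmxA mulmxA BA mul1mx.
- have pA : p *m A = 0 by rewrite -[A]mulmx1 -BA [A *m _]mulmxA AB mulmxA pe mul0mx.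
  have Bi : B *m i = 0 by rewrite -[B]mul1mx -BA -2!mulmxA [A *m _]mulmxA AB ei mulmx0.
  by rewrite mul_col_row pi1 BA pA Bi [RHS]scalar_mx_block.
- by rewrite mul_row_col AB addrC subrK.
Qed.

End HModules.

(** The action of [h] on a uniserial module: a nilpotent Jordan block. *)
Definition shift_mx (R : pzRingType) m : 'M[R]_m := \matrix_(i, j) (i == j.+1 :> nat)%:R.

Lemma shift_mxX (R : pzRingType) m k :
  shift_mx R m ^+ k = \matrix_(i, j) (i == (j + k)%N :> nat)%:R.
Proof.
elim: k => [|k IH]; first by apply/matrixP => i j; rewrite expr0 !mxE addn0.
rewrite exprSr IH; apply/matrixP => i j; rewrite [LHS]mxE [RHS]mxE.
under eq_bigr do rewrite !mxE.
have [lt_jm|le_mj] := ltnP j.+1 m.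
  rewrite (bigD1 (Ordinal lt_jm)) //= eqxx mulr1 addSnnS big1 ?addr0 // => a.
  by rewrite -val_eqE /= => /negPf->; rewrite mulr0.
rewrite big1 => [|a _]; last first.
  by rewrite (ltn_eqF (leq_trans (ltn_ord a) le_mj)) mulr0.
by rewrite addnS ltn_eqF // (leq_trans (ltn_ord i)) // (leq_trans le_mj) // ltnS leq_addr.
Qed.

(** * Spectral idempotents of an element of finite order *)

Section EigenIdempotents.
Variables (K : fieldType) (n : nat) (w : K) (A : algType K).
Hypotheses (hw : n.-primitive_root w) (n_neq0 : n%:R != 0 :> K).

(** The discrete Fourier projector onto the eigenvalue [w ^+ s] when [x ^+ n = 1]. *)
Definition eigen_idem (x : A) s : A :=
  n%:R^-1 *: \sum_(i < n) ((w ^+ s)^-1) ^+ i *: x ^+ i.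

Lemma prim_rootX_neq0 k : w ^+ k != 0.
Proof. by rewrite expf_neq0 // (prim_root_eq0 hw) -lt0n (prim_order_gt0 hw). Qed.

Lemma prim_rootX_expn k : (w ^+ k) ^+ n = 1.
Proof. by rewrite exprAC (prim_expr_order hw) expr1n. Qed.

(** Multiplying by [x] shifts the summation index; the last term wraps around to the first because
    [x] and [w ^+ s] both have n-th power 1. *)
Lemma mul_eigen_idem x s : x ^+ n = 1 -> x * eigen_idem x s = w ^+ s *: eigen_idem x s.
Proof.
move=> xn; rewrite /eigen_idem -scalerAr scalerA mulrC.
rewrite -scalerA; congr (_ *: _); rewrite scaler_sumr mulr_sumr.
transitivity (\sum_(i < n) w ^+ s *: ((w ^+ s)^-1 ^+ i.+1 *: x ^+ i.+1)).
  apply: eq_bigr => i _; rewrite -scalerAr -exprS scalerA.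
  by rewrite [w ^- s ^+ _.+1]exprS mulrA mulfV ?prim_rootX_neq0 // mul1r.
have n_gt0 := prim_order_gt0 hw.
rewrite -(prednK n_gt0) big_ord_recr [RHS]big_ord_recl /= addrC; congr (_ + _).
by rewrite prednK // exprVn prim_rootX_expn invr1 xn !expr0.
Qed.

Lemma eigen_idemC x s : eigen_idem x s * x = x * eigen_idem x s.
Proof.
rewrite -scalerAl -scalerAr mulr_suml mulr_sumr; congr (_ *: _).
by apply: eq_bigr => i _; rewrite -scalerAl -scalerAr -exprS -exprSr.
Qed.

(** After exchanging the sums, orthogonality of characters leaves only the term [i = 0]. *)
Lemma sum_eigen_idem x : \sum_(s < n) eigen_idem x s = 1.
Proof.
rewrite -scaler_sumr exchange_big /=.
have e i : \sum_(s < n) ((w ^+ s)^-1) ^+ i *: x ^+ i =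
    (if (w ^+ i)^-1 == 1 then n%:R else 0) *: x ^+ i.
  rewrite -scaler_suml; congr (_ *: _).
  under eq_bigr do rewrite exprVn exprAC -exprVn.
  by rewrite sum_unity_root // exprVn prim_rootX_expn invr1.
under eq_bigr do rewrite e invr_eq1 -(prim_order_dvd hw).
have n_gt0 := prim_order_gt0 hw.
rewrite (bigD1 (Ordinal n_gt0)) //= dvdn0 big1 ?addr0 => [|i]; last first.
  by rewrite -val_eqE /= -lt0n => i_gt0; rewrite gtnNdvd // scale0r.
by rewrite expr0 scalerA mulVf // scale1r.
Qed.
End EigenIdempotents.

(** * Uniserial modules and their multiplicities *)

Section Uniserial.
Variables (K : fieldType) (n d : nat) (q : K) (hq : d.-primitive_root q).
Variables (w : K) (c : nat).
Hypotheses (hw : n.-primitive_root w) (qw : q * w ^+ c = 1).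
Hypothesis n_neq0 : n%:R != 0 :> K.
Local Notation hmod := (hmodule n hq).
Local Notation g := (taft_g n hq).
Local Notation h := (taft_h n hq).
Local Notation E := (eigen_idem n w g).
Implicit Types V W : hmod.

(** The eigenvalue of [g] on [h^i v] for [v] of weight [w ^+ r]: as [h g = q g h], applying [h]
    multiplies a weight by [q^-1 = w ^+ c]. *)
Definition wt r i : K := w ^+ (r + c * i).

Lemma wt0 r : wt r 0 = w ^+ r. Proof. by rewrite /wt muln0 addn0. Qed.

Lemma wtS r i : q * wt r i.+1 = wt r i.
Proof. by rewrite /wt mulnS addnCA exprD mulrA qw mul1r. Qed.

Lemma wt_qX r i j : q ^+ j * wt r (i + j) = wt r i.
Proof.
elim: j => [|j IH]; first by rewrite mul1r addn0.
by rewrite exprSr addnS -mulrA wtS IH.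
Qed.

Lemma wtn r i : wt r i ^+ n = 1.
Proof. by rewrite /wt exprAC (prim_expr_order hw) expr1n. Qed.

(** The ratio [q^-1] of successive weights has order [d]. *)
Lemma wt_inj r i j : (i < d)%N -> (j < d)%N -> wt r i = wt r j -> i = j.
Proof.
move=> lt_id lt_jd wij.
have : q ^+ i == q ^+ j.
  have e k : q ^+ k * wt r k = w ^+ r by have := wt_qX r 0 k; rewrite add0n wt0.
  by apply/eqP/(mulIf (prim_rootX_neq0 hw (r + c * i))); rewrite -/(wt r i) [in RHS]wij !e.
by rewrite (eq_prim_root_expr hq) !modn_small // => /eqP.
Qed.

Lemma act_eigen_idem V s k (v : 'M_(hdim V, k)) mu : mu ^+ n = 1 ->
  act V g *m v = mu *: v -> act V (E s) *m v = (mu == w ^+ s)%:R *: v.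
Proof.
move=> mun gv.
have gX i : act V (g ^+ i) *m v = mu ^+ i *: v.
  elim: i => [|i IH]; first by rewrite !expr0 act1 mul1mx scale1r.
  by rewrite !exprS actM -mulmxA IH -scalemxAr gv scalerA -exprSr exprS.
have wsn : (w ^+ s) ^+ n = 1 by rewrite exprAC (prim_expr_order hw) expr1n.
rewrite /eigen_idem actZ act_sum -scalemxAl mulmx_suml.
under eq_bigr do rewrite actZ -scalemxAl gX scalerA -exprMn mulrC.
rewrite -scaler_suml scalerA sum_unity_root.
  rewrite -[mu / _ == 1](inj_eq (mulIf (prim_rootX_neq0 hw s))) mul1r divfK
    ?(prim_rootX_neq0 hw) //.
  by case: eqP; rewrite ?mulVf ?mulr0.
by rewrite exprMn exprVn wsn invr1 mulr1.
Qed.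

Lemma act_g_eigen_idem V s : act V g *m act V (E s) = w ^+ s *: act V (E s).
Proof.
rewrite -actM (mul_eigen_idem hw); first exact: actZ.
exact: taft_gn.
Qed.

Lemma act_eigen_idem_g V s : act V (E s) *m act V g = w ^+ s *: act V (E s).
Proof. by rewrite -act_g_eigen_idem -!actM eigen_idemC. Qed.

Section UniserialModule.
Variables l r : nat.

Definition wt_mx : 'M[K]_l := diag_mx (\row_i wt r i).

Lemma wt_mxn : wt_mx ^+ n = 1.
Proof.
have -> k : wt_mx ^+ k = diag_mx (\row_i wt r i ^+ k).
  elim: k => [|k IH].
    by apply/matrixP => i j; rewrite !mxE expr0.
  rewrite exprS IH -[LHS]/(_ *m _) mulmx_diag; congr diag_mx.
  by apply/rowP => i; rewrite !mxE exprS.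
by apply/matrixP => i j; rewrite !mxE wtn.
Qed.

Lemma shift_wt : shift_mx K l *m wt_mx = q *: (wt_mx *m shift_mx K l).
Proof.
rewrite mul_diag_mx mul_mx_diag; apply/matrixP => i j; rewrite !mxE.
by case: eqP => [->|_]; rewrite ?mulr0 ?mul0r // mulr1 mul1r wtS.
Qed.

Hypothesis le_ld : (l <= d)%N.

Lemma shift_mxd : shift_mx K l ^+ d = 0.
Proof.
apply/matrixP => i j; rewrite shift_mxX !mxE ltn_eqF //.
by rewrite (leq_trans (ltn_ord i)) // (leq_trans le_ld) ?leq_addl.
Qed.

(* M(l, r): its top [e_0] has weight [w^r], and [h e_i = e_(i+1)] has weight
   [w^(r + c (i + 1))]. *)
Definition uniserial : hmod := hmodule_of hq wt_mxn shift_mxd shift_wt.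

Lemma uniserial_g : act uniserial g = wt_mx.
Proof. exact: hmodule_of_g. Qed.

Lemma uniserial_h : act uniserial h = shift_mx K l.
Proof. exact: hmodule_of_h. Qed.

Lemma uniserial_hX k :
  act uniserial (h ^+ k) = \matrix_(i, j) (i == (j + k)%N :> nat)%:R.
Proof. by rewrite actX uniserial_h shift_mxX. Qed.

Lemma uniserial_eigen_idem s :
  act uniserial (E s) = diag_mx (\row_i (wt r i == w ^+ s)%:R).
Proof.
apply/matrixP => i j.
have -> : act uniserial (E s) i j =
    (act uniserial (E s) *m delta_mx j (0 : 'I_1)) i 0 by rewrite -colE mxE.
rewrite (@act_eigen_idem uniserial s _ _ (wt r j)) ?wtn //; last first.
  rewrite uniserial_g mul_diag_mx; apply/matrixP => a b; rewrite !mxE.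
  by case: eqP => [->|]; rewrite ?mulr0.
by rewrite !mxE eqxx andbT; case: (i =P j) => [->|_]; rewrite ?mulr1 ?mulr0.
Qed.

(** At most one basis vector has weight [w ^+ s], and [h ^+ j] moves it [j] places down or kills it,
    so the rank is 0 or 1. *)
Lemma rank_uniserial j s : \rank (act uniserial (h ^+ j * E s)) =
  (\sum_(i < l) ((wt r i == w ^+ s) && (i + j < l)%N))%N.
Proof.
rewrite actM uniserial_hX uniserial_eigen_idem mul_mx_diag.
have [i0 /eqP wi0|nw] := pickP (fun i : 'I_l => wt r i == w ^+ s); last first.
  rewrite big1 => [|i _]; last by rewrite nw.
  rewrite (_ : \matrix_(_, _) _ = 0) ?mxrank0 //.
  by apply/matrixP => a b; rewrite !mxE nw mulr0.
have wE (i : 'I_l) : (wt r i == w ^+ s) = (i == i0).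
  apply/eqP/eqP => [wi|->//]; apply/val_inj/(@wt_inj r); last by rewrite wi wi0.
    exact: leq_trans (ltn_ord i) le_ld.
  exact: leq_trans (ltn_ord i0) le_ld.
rewrite (bigD1 i0) //= big1 => [|i /negPf ni]; last by rewrite wE ni.
rewrite wi0 eqxx addn0 /=; case: ltnP => [lt_l|ge_l].
  rewrite (_ : \matrix_(_, _) _ = delta_mx (Ordinal lt_l) i0) ?mxrank_delta //.
  apply/matrixP => a b; rewrite !mxE wE -natrM mulnb; congr _%:R; congr nat_of_bool.
  by rewrite -[RHS]/((_ == _ :> nat) && _); case: (b =P i0) => [->|_]; rewrite ?andbF.
rewrite (_ : \matrix_(_, _) _ = 0) ?mxrank0 //.
apply/matrixP => a b; rewrite !mxE wE; case: (b =P i0) => [->|_]; rewrite ?mulr0 //.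
by rewrite ltn_eqF ?mul0r // (leq_trans (ltn_ord a)).
Qed.

End UniserialModule.

(* Counts the uniserial summands of length [> j] whose top has weight [w^s]. *)
Definition mult_gt j s V : int :=
  (\rank (act V (h ^+ j * E s)))%:Z -
  (\rank (act V (h ^+ j.+1 * E (s + c * n.-1))))%:Z.

Lemma mult_gt_isom j s V W : isomorphic V W -> mult_gt j s V = mult_gt j s W.
Proof. by move=> VW; congr (Posz _ - Posz _); apply: rank_act_isom. Qed.

Lemma mult_gt_dsum j s V W : mult_gt j s (dsum V W) = mult_gt j s V + mult_gt j s W.
Proof.
rewrite /mult_gt; move: (h ^+ j * E s) (h ^+ j.+1 * E (s + c * n.-1)) => x y.
by rewrite !rank_act_dsum !PoszD opprD addrACA.
Qed.

(** A position [i] of weight [w^(s - c)] in the second count matches position [i + 1] of weight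
    [w^s] in the first; only the top, at position 0, is left unmatched. *)
Lemma mult_gt_uniserial j s l r (le_ld : (l <= d)%N) :
  mult_gt j s (uniserial r le_ld) = ((j < l)%N && (r == s %[mod n]))%:Z.
Proof.
have -> : mult_gt j s (uniserial r le_ld) =
    (\sum_(i < l) ((wt r i == w ^+ s) && (i + j < l)%N))%N%:Z -
    (\sum_(i < l) ((wt r i == w ^+ (s + c * n.-1)) && (i + j.+1 < l)%N))%N%:Z.
  by congr (Posz _ - Posz _); apply: rank_uniserial.
rewrite -(eq_prim_root_expr hw) -(wt0 r).
case: l le_ld => [|l] le_ld; first by rewrite !big_ord0.
rewrite big_ord_recl [X in _ - Posz X]big_ord_recr /=.
rewrite addnS !ltnS (ltnNge (l + j)) leq_addr andbF addn0.
rewrite [X in _ - Posz X](_ : _ = \sum_(i < l) ((wt r (lift ord0 i) == w ^+ s) &&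
    (lift ord0 i + j < l.+1)))%N; first by rewrite PoszD addrK andbC.
apply: eq_bigr => i _; rewrite lift0 addSnnS; congr (nat_of_bool (_ && _)).
(* [c * n.-1] represents [- c] modulo [n]. *)
have wc : w ^+ (s + c * n.-1) * w ^+ c = w ^+ s.
  rewrite -exprD -addnA -mulnSr (prednK (prim_order_gt0 hw)) exprD mulnC.
  by rewrite [w ^+ (n * c)]exprM (prim_expr_order hw) expr1n mulr1.
rewrite -[LHS](inj_eq (mulIf (prim_rootX_neq0 hw c))) wc -exprD.
by rewrite /wt mulnS addnCA addnC.
Qed.

End Uniserial.

(** * Decomposition into uniserial modules *)

Section Decomposition.
Variables (K : fieldType) (n d : nat) (q : K) (hq : d.-primitive_root q).
Variables (w : K) (c : nat).
Hypotheses (hw : n.-primitive_root w) (qw : q * w ^+ c = 1).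
Hypothesis n_neq0 : n%:R != 0 :> K.
Local Notation hmod := (hmodule n hq).
Local Notation g := (taft_g n hq).
Local Notation h := (taft_h n hq).
Local Notation E := (eigen_idem n w g).
Local Notation wt := (wt w c).
Local Notation M := (uniserial hq hw qw).
Implicit Types V W : hmod.

Lemma act_g_hX V r j (v : 'cV_(hdim V)) : act V g *m v = w ^+ r *: v ->
  act V g *m (act V (h ^+ j) *m v) = wt r j *: (act V (h ^+ j) *m v).
Proof.
move=> gv; have qj : q ^+ j * wt r j = w ^+ r by have := wt_qX qw r 0 j; rewrite wt0.
have qj0 : q ^+ j != 0 by rewrite expf_neq0 // (prim_root_eq0 hq) -lt0n (prim_order_gt0 hq).
apply: (scalerI qj0); rewrite scalerA qj mulmxA scalemxAl -act_hXg -mulmxA gv.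
by rewrite -scalemxAr.
Qed.

(** The map [e_j |-> h^j v], equivariant on M(l, r) when [v] has weight [w ^+ r] and is killed by
    [h ^+ l]. *)
Definition cyc_mx V (v : 'cV[K]_(hdim V)) l : 'M[K]_(hdim V, l) :=
  \matrix_(i, j) (act V (h ^+ j) *m v) i 0.

Lemma mul_cyc_mx V v l m (A : 'M_(m, hdim V)) i j :
  (A *m cyc_mx v l) i j = (A *m (act V (h ^+ j) *m v)) i 0.
Proof. by rewrite !mxE; apply: eq_bigr => k _; rewrite mxE. Qed.

Lemma cyc_mx_hom V v l r (le_ld : (l <= d)%N) :
  act V g *m v = w ^+ r *: v -> act V (h ^+ l) *m v = 0 ->
  @is_hom _ _ _ _ _ (M r le_ld) V (cyc_mx v l).
Proof.
move=> gv hv; apply: is_hom_gen; apply/matrixP => i j; rewrite [RHS]mul_cyc_mx.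
  rewrite uniserial_g mul_mx_diag (act_g_hX _ gv).
  by rewrite [LHS]mxE [RHS]mxE mulrC !mxE.
rewrite uniserial_h mulmxA -actM -exprS mxE.
under eq_bigr do rewrite mxE [X in _ * X]mxE.
have [lt_jl|le_lj] := ltnP j.+1 l.
  rewrite (bigD1 (Ordinal lt_jl)) //= eqxx mulr1 big1 ?addr0 // => a.
  by rewrite -val_eqE /= => /negPf->; rewrite mulr0.
rewrite big1 => [|a _]; last by rewrite (ltn_eqF (leq_trans (ltn_ord a) le_lj)) mulr0.
by rewrite -(subnK le_lj) exprD actM -mulmxA hv mulmx0 mxE.
Qed.

(* Take [l] minimal with [h^l = 0] on [V] and an eigenvector [v] of [g] with
   [h^(l-1) v != 0]; the submodule generated by [v] is split off by a functional
   [f] that is an eigenvector of [g] with [f (h^(l-1) v) = 1]. *)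
Lemma uniserial_summand V : (0 < hdim V)%N ->
  exists l r (le_ld : (l <= d)%N) W, (0 < l)%N /\ isomorphic V (dsum (M r le_ld) W).
Proof.
move=> V_gt0; have exl : exists l, act V (h ^+ l) == 0.
  by exists d; rewrite act_hX_ge.
case: (ex_minnP exl) => -[|l'] /eqP hl min_l.
  have := mxrank1 K (hdim V); rewrite -act1 -(expr0 h) hl mxrank0 => V0.
  by rewrite -V0 in V_gt0.
have le_ld : (l'.+1 <= d)%N by apply: min_l; rewrite act_hX_ge.
(* The [E s] sum to 1, so [h ^+ l'] cannot kill all of their images. *)
have [s hs] : exists s, act V (h ^+ l') *m act V (E s) != 0.
  apply: contrapT => hE; have : act V (h ^+ l') != 0.
    by apply/negP => /min_l; rewrite ltnn.
  move/eqP; apply; rewrite -[LHS]mulmx1 -act1 -(sum_eigen_idem hw n_neq0 g).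
  rewrite act_sum mulmx_sumr big1 // => i _.
  by apply: contrapT => /eqP hi; apply: hE; exists i.
(* [v] will be column [j0] of [E s], and [f] the coordinate [i0] after projection to the weight of
   [h^l' v], normalized by [a]. *)
have [i0 [j0 ha]] : exists i0 j0, (act V (h ^+ l') *m act V (E s)) i0 j0 != 0.
  by apply/matrix0Pn.
set a := (_ *m _) i0 j0 in ha.
pose v : 'cV_(hdim V) := act V (E s) *m delta_mx j0 0.
have gv : act V g *m v = w ^+ s *: v.
  by rewrite /v mulmxA (act_g_eigen_idem hw) -scalemxAl.
pose t := (s + c * l')%N.
pose f : 'rV_(hdim V) := a^-1 *: (delta_mx 0 i0 *m act V (E t)).
have fg : f *m act V g = w ^+ t *: f.
  by rewrite -scalemxAl -mulmxA act_eigen_idem_g // -scalemxAr !scalerA mulrC.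
(* The [h^k v] with [k <= l'] have distinct weights, and [f] detects only that of [k = l']; for
   larger [k] they vanish. *)
have fhv k : (f *m (act V (h ^+ k) *m v)) 0 0 = (k == l')%:R.
  have [lt_l|le_k] := ltnP l' k.
    rewrite (gtn_eqF lt_l) -(subnK lt_l) exprD actM hl mulmx0.
    by rewrite mul0mx mulmx0 mxE.
  rewrite -scalemxAl -mulmxA (act_eigen_idem hw n_neq0 _ (wtn c hw s k)) ?(act_g_hX _ gv) //.
  have -> : (wt s k == w ^+ t) = (k == l').
    apply/eqP/eqP => [wk|->//]; apply: (wt_inj hq hw qw) wk => //.
    exact: leq_ltn_trans le_k le_ld.
  case: (k =P l') => [->|_]; last by rewrite scale0r mulmx0 scaler0 mxE.
  rewrite scale1r /v [act _ _ *m (_ *m _)]mulmxA -colE -rowE mxE.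
  by rewrite [X in _ * X]mxE [X in _ * X]mxE mulVf.
(* Row [i] is [f] composed with [h ^+ (l' - i)], so its value at [h^j v] is 1 if [i = j] and 0
   otherwise. *)
pose p : 'M_(l'.+1, hdim V) := \matrix_(i, j) (f *m act V (h ^+ (l' - i))) 0 j.
have mul_p m (A : 'M_(hdim V, m)) i j :
    (p *m A) i j = (f *m act V (h ^+ (l' - i)) *m A) 0 j.
  by rewrite [LHS]mxE [RHS]mxE; apply: eq_bigr => b _; rewrite [p _ _]mxE.
have [W VW] : exists W, isomorphic V (dsum (M s le_ld) W).
  apply: (@split_dsum _ _ _ _ _ _ (M s le_ld) (cyc_mx v l'.+1) p).
  - by apply: cyc_mx_hom => //; rewrite hl mul0mx.
  - apply: is_hom_gen; apply/matrixP => i j; rewrite mul_p.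
      rewrite uniserial_g mul_diag_mx -mulmxA act_hXg -scalemxAr mulmxA fg -scalemxAl.
      rewrite scalerA !mxE; congr (_ * _).
      by rewrite -[RHS](wt_qX qw _ _ (l' - i)) subnKC // -ltnS (ltn_ord i).
    rewrite -mulmxA -actM -exprSr uniserial_h [RHS]mxE.
    under eq_bigr do rewrite mxE.
    case: i => -[|i] lt_i /=.
      by rewrite subn0 hl mulmx0 mxE big1 // => b _; rewrite mul0r.
    rewrite (bigD1 (Ordinal (ltnW lt_i))) //= eqxx mul1r big1 ?addr0 => [|b].
      by rewrite [RHS]mxE /= subnSK.
    by rewrite -val_eqE /= eqSS eq_sym => /negPf->; rewrite mul0r.
  - apply/matrixP => i j; rewrite mul_p mul_cyc_mx -mulmxA.
    rewrite [act V (h ^+ _) *m (_ *m _)]mulmxA -actM -exprD fhv mxE; congr _%:R.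
    congr nat_of_bool; rewrite -[RHS]/(i == j :> nat) [RHS]eq_sym.
    by rewrite -[RHS](eqn_add2l (l' - i)) subnK // -ltnS (ltn_ord i).
by exists l'.+1, s, le_ld, W.
Qed.

(** [V] is isomorphic to [dsum V V], so its class is twice itself. *)
Lemma cls_dim0 V : hdim V = 0%N -> cls V = 0.
Proof.
move=> V0; have F (i : 'I_(hdim V)) : False by case: i => i; rewrite V0.
have : isomorphic V (dsum V V).
  exists 0, 0; first by move=> x; rewrite mul0mx mulmx0.
  split; apply/matrixP => i; last by case: (F i).
  by case: (F (match split i with inl k => k | inr k => k end)).
by move/cls_isom/eqP; rewrite cls_dsum -subr_eq0 opprD addNKr oppr_eq0 => /eqP.
Qed.

(** Uniserial summands are split off by induction on the dimension. *)
Lemma green_gen (P : green n hq -> Prop) :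
  P 0 -> (forall x y, P x -> P y -> P (x - y)) ->
  (forall l r (le_ld : (l <= d)%N), P (cls (M r le_ld))) -> forall x, P x.
Proof.
move=> P0 PB PM; elim/green_ind => // V.
have [m] := ubnP (hdim V); elim: m V => // m IH V le_m.
have [|V_gt0] := posnP (hdim V); first by move/cls_dim0->.
have [l [r [le_ld [W [l_gt0 VW]]]]] := uniserial_summand V_gt0.
have dimV := isom_hdim VW; rewrite (cls_isom VW) cls_dsum.
rewrite -[cls W]opprK -[- cls W]sub0r; apply: (PB _ _ _ (PB _ _ P0 _)) => //.
by apply: IH; rewrite -ltnS (leq_trans _ le_m) // ltnS dimV /= -add1n leq_add2r.
Qed.

(** Since [h ^+ d = 0] on every module, maps from M(d, r) amount to vectors of weight [w ^+ r];
    [E r] corrects any preimage to one of that weight. *)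
Lemma uniserial_projective r : is_projective (M r (leqnn d)).
Proof.
move=> V W f p fH f_surj pH.
pose o : 'I_d := Ordinal (prim_order_gt0 hq).
have [v1 fv1] := f_surj (col o p).
have gp : act W g *m col o p = w ^+ r *: col o p.
  rewrite colE mulmxA -pH -mulmxA uniserial_g [RHS]scalemxAr; congr (_ *m _).
  rewrite mul_diag_mx; apply/matrixP => i j; rewrite !mxE.
  by case: eqP => [->|]; rewrite ?mulr0 //= wt0.
have wr : (w ^+ r) ^+ n = 1 by rewrite (prim_rootX_expn hw).
exists (cyc_mx (act V (E r) *m v1) d).
  apply: cyc_mx_hom; last by rewrite act_hX_ge // mul0mx.
  by rewrite mulmxA (act_g_eigen_idem hw) -scalemxAl.
apply/matrixP => i j; rewrite mul_cyc_mx !mulmxA fH -[_ *m f *m _]mulmxA fH.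
rewrite -!mulmxA fv1 (act_eigen_idem hw n_neq0 _ wr gp) eqxx scale1r.
rewrite colE mulmxA -pH -colE mxE uniserial_hX mxE.
rewrite (bigD1 j) //= mxE add0n eqxx mulr1 big1 ?addr0 // => k /negPf nk.
by rewrite mxE add0n -[_ == _]/(k == j) nk mulr0.
Qed.

End Decomposition.

(** * Tensors of column vectors *)

Lemma mulmx1C_dim (R : comNzRingType) m k (A : 'M[R]_(m, k)) (B : 'M[R]_(k, m)) :
  k = m -> A *m B = 1%:M -> B *m A = 1%:M.
Proof. by move=> eq_km; case: m / eq_km A B => A B; apply: mulmx1C. Qed.

Definition tensv (R : pzRingType) m k (u : 'cV[R]_m) (v : 'cV[R]_k) : 'cV[R]_(m * k) :=
  u *t v.

(** The index is any natural number, and the vector is 0 out of range, so that the shift has no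
    boundary case. *)
Definition basisv (R : pzRingType) m j : 'cV[R]_m := \col_i (i == j :> nat)%:R.

Lemma basisv_ge (R : pzRingType) m j : (m <= j)%N -> basisv R m j = 0.
Proof.
move=> le_mj; apply/colP => i; rewrite !mxE ltn_eqF //.
exact: leq_trans (ltn_ord i) le_mj.
Qed.

Lemma mul_tensv (R : comPzRingType) m k (A : 'M[R]_m) (B : 'M[R]_k) u v :
  (A *t B) *m tensv u v = tensv (A *m u) (B *m v).
Proof. exact: (tensmx_mul A B u v). Qed.

Lemma tensvE (R : pzRingType) m k (u : 'cV[R]_m) (v : 'cV[R]_k) i :
  tensv u v i 0 = u (mxtens_unindex i).1 0 * v (mxtens_unindex i).2 0.
Proof. by rewrite mxE; congr (u _ _ * v _ _); apply/val_inj; rewrite /= ?modn1. Qed.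

Lemma tensvZl (R : comPzRingType) m k a (u : 'cV[R]_m) (v : 'cV[R]_k) :
  tensv (a *: u) v = a *: tensv u v.
Proof. by apply/colP => i; rewrite tensvE [RHS]mxE tensvE mxE mulrA. Qed.

Lemma tensvZr (R : comPzRingType) m k a (u : 'cV[R]_m) (v : 'cV[R]_k) :
  tensv u (a *: v) = a *: tensv u v.
Proof. by apply/colP => i; rewrite tensvE [RHS]mxE tensvE mxE mulrCA. Qed.

Lemma tensv0l (R : pzRingType) m k (v : 'cV[R]_k) : tensv (0 : 'cV[R]_m) v = 0.
Proof. by apply/colP => i; rewrite tensvE !mxE mul0r. Qed.

Lemma tensv0r (R : pzRingType) m k (u : 'cV[R]_m) : tensv u (0 : 'cV[R]_k) = 0.
Proof. by apply/colP => i; rewrite tensvE !mxE mulr0. Qed.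

Lemma delta_tensv (R : pzRingType) m k (i : 'I_(m * k)) :
  delta_mx i 0 = tensv (basisv R m (mxtens_unindex i).1) (basisv R k (mxtens_unindex i).2).
Proof.
apply/colP => j; rewrite tensvE !mxE eqxx andbT -natrM mulnb; congr _%:R.
congr nat_of_bool; rewrite -(can_eq (@mxtens_unindexK m k)) -pair_eqE.
by [].
Qed.

Lemma mul_shift_basisv (R : pzRingType) m j :
  shift_mx R m *m basisv R m j = basisv R m j.+1.
Proof.
apply/colP => i; rewrite !mxE.
under eq_bigr do rewrite !mxE.
have [lt_jm|le_mj] := ltnP j m.
  rewrite (bigD1 (Ordinal lt_jm)) //= eqxx mulr1 big1 ?addr0 // => a.
  by rewrite -val_eqE /= => /negPf->; rewrite mulr0.
rewrite big1 => [|a _]; last by rewrite (ltn_eqF (leq_trans (ltn_ord a) le_mj)) mulr0.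
by rewrite ltn_eqF // (leq_trans (ltn_ord i)) // ltnW.
Qed.

(** * Tensoring with the two-dimensional uniserial module *)

Section Fusion.
Variables (K : fieldType) (n d : nat) (q : K) (hq : d.-primitive_root q).
Variables (w : K) (c : nat).
Hypotheses (hw : n.-primitive_root w) (qw : q * w ^+ c = 1).
Local Notation hmod := (hmodule n hq).
Local Notation g := (taft_g n hq).
Local Notation h := (taft_h n hq).
Local Notation wt := (wt w c).
Local Notation M := (uniserial hq hw qw).
Implicit Types V W : hmod.

Lemma isom_surj V W (f : 'M[K]_(hdim V, hdim W)) : is_hom f -> hdim W = hdim V ->
  (forall i, exists u : 'cV_(hdim W), f *m u = delta_mx i 0) -> isomorphic V W.
Proof.
move=> fH eqd /choice[u fu]; apply: isom_sym.
pose f' : 'M_(hdim W, hdim V) := \matrix_(i, j) u j i 0.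
have ff' : f *m f' = 1%:M.
  apply/matrixP => i j; transitivity ((f *m u j) i 0); last by rewrite fu !mxE andbT.
  by rewrite !mxE; apply: eq_bigr => k _; rewrite !mxE.
by exists f, f' => //; split=> //; apply: mulmx1C_dim ff'.
Qed.

(** By the dimension count it is enough that the [h]-orbits of [a] and [b] span [V]; spanning is
    phrased as an induction principle. *)
Lemma isom_dsum_cyc V (a b : 'cV[K]_(hdim V)) l m r s
    (le_ld : (l <= d)%N) (le_md : (m <= d)%N) :
  act V g *m a = w ^+ r *: a -> act V (h ^+ l) *m a = 0 ->
  act V g *m b = w ^+ s *: b -> act V (h ^+ m) *m b = 0 ->
  (l + m)%N = hdim V ->
  (forall P : 'cV[K]_(hdim V) -> Prop,
     (forall k x y, P x -> P y -> P (k *: x + y)) ->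
     (forall j, P (act V (h ^+ j) *m a)) -> (forall j, P (act V (h ^+ j) *m b)) ->
     forall i, P (delta_mx i 0)) ->
  isomorphic V (dsum (M r le_ld) (M s le_md)).
Proof.
move=> ga ha gb hb dimV spanV.
pose f : 'M_(hdim V, l + m) := row_mx (cyc_mx a l) (cyc_mx b m).
have faH := cyc_mx_hom hw qw le_ld ga ha; have fbH := cyc_mx_hom hw qw le_md gb hb.
have cyc_col v j k (lt_jk : (j < k)%N) :
    cyc_mx v k *m delta_mx (Ordinal lt_jk) 0 = act V (h ^+ j) *m v.
  by apply/colP => i; rewrite -colE !mxE.
have h_ge (v : 'cV_(hdim V)) j k : (k <= j)%N -> act V (h ^+ k) *m v = 0 -> act V (h ^+ j) *m v = 0.
  by move=> le_kj hk; rewrite -(subnK le_kj) exprD actM -mulmxA hk mulmx0.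
apply: (@isom_surj _ (dsum (M r le_ld) (M s le_md)) f) => //.
  by move=> x; rewrite /= /dsum_act mul_row_block mul_mx_row !mulmx0 addr0 add0r faH fbH.
apply: (spanV (fun x => exists u, f *m u = x)) => [k x y [u <-] [v <-]|j|j].
- by exists (k *: u + v); rewrite mulmxDr scalemxAr.
- have [lt_jl|le_lj] := ltnP j l.
    exists (col_mx (delta_mx (Ordinal lt_jl) 0) 0).
    by rewrite mul_row_col mulmx0 addr0 cyc_col.
  by exists 0; rewrite mulmx0 (h_ge _ _ _ le_lj ha).
- have [lt_jm|le_mj] := ltnP j m.
    exists (col_mx 0 (delta_mx (Ordinal lt_jm) 0)).
    by rewrite mul_row_col mulmx0 add0r cyc_col.
  by exists 0; rewrite mulmx0 (h_ge _ _ _ le_mj hb).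
Qed.

Section TensorTwo.
Hypothesis d_ge2 : (2 <= d)%N.
Variables (l r : nat) (le_ld : (l <= d)%N).
Local Notation V := (tens (M 0 d_ge2) (M r le_ld)).
Local Notation x0 j := (tensv (basisv K 2 0) (basisv K l j)).
Local Notation x1 j := (tensv (basisv K 2 1) (basisv K l j)).
(** The coefficient of [x1 j.-1] in [h^j (x0 0)] for [j > 0]; this geometric sum of ratio [q^-1]
    vanishes exactly when [d] divides [j]. *)
Let A j := \sum_(i < j) wt r i.

Let wt_basisv m s j : wt_mx w c m s *m basisv K m j = wt s j *: basisv K m j.
Proof.
rewrite mul_diag_mx; apply/colP => i; rewrite !mxE.
by case: eqP => [->|_]; rewrite ?mulr0.
Qed.

Let g0 j : act V g *m x0 j = wt r j *: x0 j.
Proof.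
rewrite tens_act_g /tens_g mul_tensv !uniserial_g !wt_basisv tensvZl tensvZr.
by rewrite wt0 expr0 scale1r.
Qed.

Let g1 j : act V g *m x1 j = wt r j.+1 *: x1 j.
Proof.
rewrite tens_act_g /tens_g mul_tensv !uniserial_g !wt_basisv tensvZl tensvZr.
by rewrite scalerA /wt add0n muln1 -exprD mulnS addnCA.
Qed.

Let hV : act V h = 1%:M *t shift_mx K l + shift_mx K 2 *t wt_mx w c l r.
Proof.
rewrite tens_act_h /tens_h; congr (_ *t _ + _ *t _).
- exact: uniserial_h.
- exact: uniserial_h.
- exact: uniserial_g.
Qed.

Let h0 j : act V h *m x0 j = x0 j.+1 + wt r j *: x1 j.
Proof.
rewrite hV mulmxDl !mul_tensv !mul1mx.
by rewrite !mul_shift_basisv wt_basisv tensvZr.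
Qed.

Let h1 j : act V h *m x1 j = x1 j.+1.
Proof.
rewrite hV mulmxDl !mul_tensv !mul1mx.
by rewrite !mul_shift_basisv [basisv K 2 2]basisv_ge // tensv0l addr0.
Qed.

Let AS j : A j.+1 = A j + wt r j. Proof. by rewrite /A big_ord_recr. Qed.

Let hX_x0 j : act V (h ^+ j.+1) *m x0 0 = x0 j.+1 + A j.+1 *: x1 j.
Proof.
elim: j => [|j IH]; first by rewrite expr1 h0 AS /A big_ord0 add0r.
rewrite exprS actM -mulmxA IH mulmxDr -scalemxAr h0 h1 [A j.+2]AS scalerDl.
by rewrite -addrA [_ *: x1 _ + _]addrC.
Qed.

Let hX_x1 j : act V (h ^+ j) *m x1 0 = x1 j.
Proof.
elim: j => [|j IH]; first by rewrite expr0 act1 mul1mx.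
by rewrite exprS actM -mulmxA IH h1.
Qed.

Let delta_x (P : 'cV[K]_(hdim V) -> Prop) :
  (forall j, P (x0 j)) -> (forall j, P (x1 j)) -> forall i, P (delta_mx i 0).
Proof.
move=> P0 P1 i; rewrite delta_tensv.
by case: (mxtens_unindex i) => -[[|[|]]].
Qed.

Let A_geom j : A j * (w ^+ c - 1) = w ^+ r * (w ^+ c ^+ j - 1).
Proof.
rewrite [in RHS]subrX1 mulrCA [LHS]mulrC; congr (_ * _).
by rewrite /A mulr_sumr; apply: eq_bigr => i _; rewrite /wt exprD exprM.
Qed.

Let wcX j : (w ^+ c ^+ j == 1) = (d %| j)%N.
Proof.
have -> : w ^+ c = q^-1.
  by rewrite -[LHS]mul1r -(mulVf (x := q)) ?(prim_root_eq0 hq) -?lt0n ?(prim_order_gt0 hq) //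
    -mulrA qw mulr1.
by rewrite exprVn invr_eq1 (prim_order_dvd hq).
Qed.

(** [x0 0] generates M(l+1, r) and [b] generates M(l-1, r+c); they span because [A l != 0] for
    [0 < l < d]. *)
Lemma isom_tens_two (le_Sld : (l.+1 <= d)%N) (le_Pld : (l.-1 <= d)%N) : (0 < l)%N ->
  isomorphic V (dsum (M r le_Sld) (M (r + c) le_Pld)).
Proof.
move=> l_gt0.
have Al : A l != 0.
  apply: contraTneq isT => Al0; have := A_geom l; rewrite Al0 mul0r => /esym/eqP.
  rewrite mulf_eq0 (negPf (prim_rootX_neq0 hw r)) subr_eq0 wcX /=.
  by rewrite gtnNdvd.
(* The coefficient is chosen in weight [w^(r + c)] so that [h^(l-1) b = 0]. *)
pose b := x0 1 + (A 1 - A l) *: x1 0.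
have hb j : act V (h ^+ j) *m b = x0 j.+1 + (A j.+1 - A l) *: x1 j.
  elim: j => [|j IH]; first by rewrite expr0 act1 mul1mx.
  rewrite exprS actM -mulmxA IH mulmxDr -scalemxAr h0 h1 [A j.+2]AS -addrA -scalerDl.
  by rewrite addrA [wt r _ + _]addrC.
apply: (@isom_dsum_cyc V (x0 0) b).
- by rewrite g0 wt0.
- by rewrite hX_x0 ![basisv K l _]basisv_ge // !tensv0r scaler0 addr0.
- by rewrite mulmxDr -scalemxAr g0 g1 scalerA mulrC -scalerA -scalerDr /wt muln1.
- by rewrite hb prednK // subrr scale0r addr0 [basisv K l _]basisv_ge // tensv0r.
- by rewrite /= mul2n -addnn addSnnS prednK.
move=> P PD Pa Pb.
have P0 : P 0 by have := PD (-1) _ _ (Pa 0%N) (Pa 0%N); rewrite scaleN1r addNr.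
have PZ k x : P x -> P (k *: x) by move=> Px; rewrite -[_ *: _]addr0; apply: PD.
have P1 j : P (x1 j).
  have -> : x1 j = (A l)^-1 *: (-1 *: (act V (h ^+ j) *m b) + act V (h ^+ j.+1) *m x0 0).
    rewrite hb hX_x0 scaleN1r opprD addrACA addNr add0r.
    by rewrite -scaleNr -scalerDl opprB subrK scalerA mulVf ?scale1r.
  exact/PZ/PD.
apply: delta_x => // -[|j].
  by have := Pa 0%N; rewrite expr0 act1 mul1mx.
have := PD (- (A j.+1 - A l)) _ _ (P1 j) (Pb j).
by rewrite hb addrCA -scalerDl addNr scale0r addr0.
Qed.

(** Now [A d = 0], so [h ^+ d] already kills [x0 0], and [x0 0] and [x1 0] serve as generators. *)
Lemma isom_tens_two_top : l = d ->
  isomorphic V (dsum (M r le_ld) (M (r + c) le_ld)).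
Proof.
move=> eq_ld.
have Al : A l = 0.
  apply: (mulIf (x := w ^+ c - 1)); last first.
    have /eqP := wcX l; rewrite eq_ld dvdnn => /eqP/eqP wd.
    by rewrite mul0r A_geom wd subrr mulr0.
  by rewrite subr_eq0 -[w ^+ c]expr1 wcX gtnNdvd.
have ha : act V (h ^+ l) *m x0 0 = 0.
  have l_gt0 : (0 < l)%N by rewrite eq_ld (prim_order_gt0 hq).
  by rewrite -[in h ^+ _](prednK l_gt0) hX_x0 prednK // Al scale0r addr0
    [basisv K l _]basisv_ge // tensv0r.
apply: (@isom_dsum_cyc V (x0 0) (x1 0)).

- by rewrite g0 wt0.
- exact: ha.
- by rewrite g1 /wt muln1.
- by rewrite hX_x1 [basisv K l _]basisv_ge // tensv0r.
- by rewrite /= mul2n -addnn.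
move=> P PD Pa Pb.
have P1 j : P (x1 j) by rewrite -hX_x1.
apply: delta_x => // -[|j].
  by have := Pa 0%N; rewrite expr0 act1 mul1mx.
have := PD (- A j.+1) _ _ (P1 j) (Pa j.+1).
by rewrite hX_x0 addrCA scaleNr addNr addr0.
Qed.

End TensorTwo.

End Fusion.

(** * The commuting integer matrices of the fusion rules *)

Section FusionMatrices.
Variables m n c : nat.
Hypothesis n_gt0 : (0 < n)%N.

Definition cycle_mx : 'M[int]_n := \matrix_(i, j) (i == j.+1 %[mod n])%:R.

Definition residuev r : 'cV[int]_n := \col_i (i == r %[mod n])%:R.

(* [lengthv l] is the l-th basis vector counted from 1, so that it vanishes for
   [l = 0] and, as projectives are killed, for [l = m + 1]. *)
Definition lengthv l : 'cV[int]_m := if l is l'.+1 then basisv int m l' else 0.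

Lemma cycle_residuev r : cycle_mx *m residuev r = residuev r.+1.
Proof.
apply/colP => i; rewrite !mxE; under eq_bigr do rewrite !mxE.
have lt_rn : (r %% n < n)%N by rewrite ltn_mod.
rewrite (bigD1 (Ordinal lt_rn)) //= modn_mod eqxx mulr1 big1 => [|j].
  by rewrite addr0 -addn1 modnDml addn1.
by rewrite -val_eqE /= (modn_small (ltn_ord j)) => /negPf->; rewrite mulr0.
Qed.

Lemma cycleX_residuev k r : cycle_mx ^+ k *m residuev r = residuev (r + k).
Proof.
elim: k => [|k IH]; first by rewrite expr0 mul1mx addn0.
by rewrite exprS -[_ * _]/(_ *m _) -mulmxA IH cycle_residuev addnS.
Qed.

Lemma cycle_mxTK : cycle_mx^T *m cycle_mx = 1%:M.
Proof.
apply/matrixP => i j; rewrite !mxE; under eq_bigr do rewrite !mxE.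
have lt_in : (i.+1 %% n < n)%N by rewrite ltn_mod.
rewrite (bigD1 (Ordinal lt_in)) //= modn_mod eqxx mul1r big1 => [|k].
  by rewrite addr0 -[i.+1]addn1 -[j.+1]addn1 eqn_modDr !modn_small.
by rewrite -val_eqE /= (modn_small (ltn_ord k)) => /negPf->; rewrite mul0r.
Qed.

Lemma cycle_mxKT : cycle_mx *m cycle_mx^T = 1%:M.
Proof. exact/mulmx1C/cycle_mxTK. Qed.

Lemma residuev_small (b : 'I_n) : residuev b = basisv int n b.
Proof. by apply/colP => i; rewrite !mxE !modn_small. Qed.

Lemma shift_lengthv l : (0 < l)%N -> shift_mx int m *m lengthv l = lengthv l.+1.
Proof. by case: l => // l _; apply: mul_shift_basisv. Qed.

Lemma shiftT_lengthv l : (l <= m)%N -> (shift_mx int m)^T *m lengthv l = lengthv l.-1.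
Proof.
case: l => [|l] lt_lm; first by rewrite mulmx0.
apply/colP => i; rewrite mxE; under eq_bigr do rewrite !mxE.
rewrite (bigD1 (Ordinal lt_lm)) //= eqxx mulr1 big1 ?addr0 => [|a]; last first.
  by rewrite -val_eqE /= => /negPf->; rewrite mulr0.
by case: l {lt_lm} => [|l]; rewrite mxE // eqSS eq_sym.
Qed.

Lemma lengthv_max : lengthv m.+1 = 0.
Proof. exact: basisv_ge. Qed.

Definition twist_fusion : 'M[int]_(m * n) := 1%:M *t cycle_mx.

(** Tensoring with M(2, 0) modulo projectives: the shift raises the length, its transpose lowers it
    and moves the top by [c]. *)
Definition two_fusion : 'M[int]_(m * n) :=
  shift_mx int m *t 1%:M + (shift_mx int m)^T *t (cycle_mx ^+ c).

(** Transposes are included to meet the hypothesis of [bicommutant_normal]. *)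
Definition fusion_gen (A : 'M[int]_(m * n)) : Prop :=
  [\/ A = twist_fusion, A = twist_fusion^T, A = two_fusion | A = two_fusion^T].

Lemma fusion_genT A : fusion_gen A -> fusion_gen A^T.
Proof.
by case=> ->; rewrite ?trmxK; [apply: Or42|apply: Or41|apply: Or44|apply: Or43].
Qed.

Lemma twist_fusion_comm (B : 'M[int]_n) : B *m cycle_mx = cycle_mx *m B ->
  (1%:M *t B) *m two_fusion = two_fusion *m (1%:M *t B).
Proof.
move=> BT; have BTc : B *m cycle_mx ^+ c = cycle_mx ^+ c *m B.
  exact: (@commrX _ (B : 'M[int]_n) cycle_mx c BT).
by rewrite mulmxDr mulmxDl !tensmx_mul !mul1mx !mulmx1 BTc.
Qed.

(* The dual of the two-dimensional module is a twist of it, hence two_fusion^T is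
   a twist of two_fusion. *)
Lemma two_fusionT : two_fusion^T = (1%:M *t (cycle_mx^T) ^+ c) *m two_fusion.
Proof.
have trX k : (cycle_mx ^+ k)^T = cycle_mx^T ^+ k.
  elim: k => [|k IH]; first by rewrite !expr0 trmx1.
  by rewrite exprS -[_ * _]/(_ *m _) trmx_mul IH [RHS]exprSr.
have TK : cycle_mx^T ^+ c *m cycle_mx ^+ c = 1%:M.
  rewrite mulmxE -exprMn_comm; first by rewrite -mulmxE cycle_mxTK expr1n.
  by rewrite /GRing.comm -mulmxE cycle_mxTK cycle_mxKT.
rewrite /two_fusion linearD /= !trmx_tens trmxK trmx1 trX mulmxDr !tensmx_mul.
by rewrite !mul1mx mulmx1 TK addrC.
Qed.

(** [two_fusion] commutes with the twist and its inverse, hence with its own transpose by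
    [two_fusionT]; the other cases follow by transposition. *)
Lemma fusion_gen_comm A B : fusion_gen A -> fusion_gen B -> A *m B = B *m A.
Proof.
have ff : twist_fusion^T *m twist_fusion = twist_fusion *m twist_fusion^T.
  by rewrite trmx_tens trmx1 !tensmx_mul cycle_mxTK cycle_mxKT.
have ft : twist_fusion *m two_fusion = two_fusion *m twist_fusion.
  exact: twist_fusion_comm.
have fTt : twist_fusion^T *m two_fusion = two_fusion *m twist_fusion^T.
  rewrite trmx_tens trmx1; apply: twist_fusion_comm.
  by rewrite cycle_mxTK cycle_mxKT.
have tt : two_fusion *m two_fusion^T = two_fusion^T *m two_fusion.
  rewrite two_fusionT [LHS]mulmxA -twist_fusion_comm //.
  rewrite mulmxE; apply: commr_sym; apply: commrX.
  by rewrite /GRing.comm -mulmxE cycle_mxTK cycle_mxKT.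
have tr X Y : X *m Y = Y *m X -> X^T *m Y^T = Y^T *m X^T :> 'M[int]_(m * n).
  by move=> XY; rewrite -!trmx_mul XY.
have ftT := tr _ _ fTt; rewrite trmxK in ftT; have fTtT := tr _ _ ft.
by case=> -> [] ->.
Qed.

End FusionMatrices.

(** * The Green ring modulo projective classes *)

Section StableGreenRing.
Variables (K : fieldType) (n m : nat) (q : K) (hq : m.+1.-primitive_root q).
Variables (w : K) (c : nat).
Hypotheses (hw : n.-primitive_root w) (qw : q * w ^+ c = 1).
Hypotheses (n_neq0 : n%:R != 0 :> K) (m_gt0 : (0 < m)%N).
Local Notation R := (green n hq).
Local Notation g := (taft_g n hq).
Local Notation h := (taft_h n hq).
Local Notation M := (uniserial hq hw qw).
Local Notation N := (m * n)%N.
Local Notation residuev := (residuev n).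
Local Notation lengthv := (lengthv m).

Let n_gt0 : (0 < n)%N := prim_order_gt0 hw.
Let gen := @green_gen _ _ _ _ hq w c hw qw n_neq0.

(** Counts the summands of length exactly [j + 1] whose top has weight [w ^+ s]. *)
Definition mult j s (V : hmodule n hq) : int :=
  mult_gt w c j s V - mult_gt w c j.+1 s V.

Lemma mult_isom j s V W : isomorphic V W -> mult j s V = mult j s W.
Proof. by move=> VW; rewrite /mult !(mult_gt_isom w c _ _ VW). Qed.

Lemma mult_dsum j s V W : mult j s (dsum V W) = mult j s V + mult j s W.
Proof. by rewrite /mult !mult_gt_dsum opprD addrACA. Qed.

(** Coordinates on the [M(l, r)] with [1 <= l <= m]; as [d = m.+1], exactly the projective M(d, r)
    are left out. *)
Definition stable_mult (x : R) : 'cV[int]_N :=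
  \col_k green_lift (mult (mxtens_unindex k).1 (mxtens_unindex k).2) x.

Lemma stable_multB x y : stable_mult (x - y) = stable_mult x - stable_mult y.
Proof.
by apply/colP => k; rewrite !mxE; apply: green_liftB; [apply: mult_isom|apply: mult_dsum].
Qed.

Lemma stable_mult0 : stable_mult 0 = 0.
Proof. by rewrite -[X in stable_mult X](subrr 0) stable_multB subrr. Qed.

Lemma stable_multD x y : stable_mult (x + y) = stable_mult x + stable_mult y.
Proof. by rewrite -[y in LHS]opprK -[- y]sub0r !stable_multB stable_mult0 sub0r opprK. Qed.

Lemma stable_mult_uniserial l r (le_ld : (l <= m.+1)%N) :
  stable_mult (cls (M r le_ld)) = tensv (lengthv l) (residuev r).
Proof.
apply/colP => k; rewrite tensvE mxE green_lift_cls; [|exact: mult_isom|exact: mult_dsum].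
case: (mxtens_unindex k) => a b /=; rewrite /mult !mult_gt_uniserial // mxE [r == b %[mod n]]eq_sym.
case: l le_ld => [|l] le_ld; first by rewrite mxE mul0r.
rewrite mxE !ltnS; case: (b == r %[mod n]); last by rewrite !andbF mulr0.
by rewrite !andbT mulr1; case: ltngtP.
Qed.

Lemma cls_twist l r (le_ld : (l <= m.+1)%N) :
  cls (M 1 (ltn0Sn m)) * cls (M r le_ld) = cls (M r.+1 le_ld).
Proof.
rewrite clsM; apply/cls_isom.
apply: (@isom_reindex _ _ _ _ _ (tens (M 1 (ltn0Sn m)) (M r le_ld)) (M r.+1 le_ld)
  (fun k => mxtens_index (0 : 'I_1, k)) (fun k => (mxtens_unindex k).2)).
- by move=> k; rewrite mxtens_indexK.
- by move=> k; case: (mxtens_indexP k) => a b; rewrite mxtens_indexK [a]ord1.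
- move=> i j; rewrite tens_act_g /tens_g tensmxE !uniserial_g !mxE eqxx mulr1n mulrnAr.
  by rewrite /wt muln0 addn0 -exprD addnA add1n.
- move=> i j; rewrite tens_act_h /tens_h addmxE !tensmxE !uniserial_h [in LHS]mxE.
  by rewrite [X in X * _ + _]mxE [X in _ + X * _]mxE /= mul0r addr0 mul1r mxE.
Qed.

Lemma cls_two l r (lt_ld : (l.+2 <= m.+1)%N) :
  cls (M 0 (m_gt0 : (2 <= m.+1)%N)) * cls (M r (ltnW lt_ld)) =
  cls (M r lt_ld) + cls (M (r + c) (ltnW (ltnW lt_ld))).
Proof. by rewrite clsM -cls_dsum; apply/cls_isom/isom_tens_two. Qed.

Lemma cls_two_top r :
  cls (M 0 (m_gt0 : (2 <= m.+1)%N)) * cls (M r (leqnn m.+1)) =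
  cls (M r (leqnn m.+1)) + cls (M (r + c) (leqnn m.+1)).
Proof. by rewrite clsM -cls_dsum; apply/cls_isom/isom_tens_two_top. Qed.

Lemma cls_uniserial_eq l r r' (le_ld le_ld' : (l <= m.+1)%N) : r = r' %[mod n] ->
  cls (M r le_ld) = cls (M r' le_ld').
Proof.
move=> rr'; apply/cls_isom/(@isom_reindex _ _ _ _ _ (M r le_ld) (M r' le_ld') id id) => // i j.
  rewrite !uniserial_g !mxE /wt !exprD.
  by have /eqP := rr'; rewrite -(eq_prim_root_expr hw) => /eqP->.
by rewrite !uniserial_h.
Qed.

Lemma cls_one : cls (M 0 (ltn0Sn m)) = 1.
Proof.
apply/cls_isom/(@isom_reindex _ _ _ _ _ (M 0 (ltn0Sn m)) (triv n hq) id id) => // i j.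
  by rewrite hmodule_of_g uniserial_g [i]ord1 [j]ord1 !mxE wt0 expr0.
by rewrite hmodule_of_h uniserial_h [i]ord1 [j]ord1 !mxE.
Qed.

Definition acts_by (a : R) (A : 'M[int]_N) : Prop :=
  forall x, stable_mult (a * x) = A *m stable_mult x.

Lemma twist_acts_by : acts_by (cls (M 1 (ltn0Sn m))) (twist_fusion m n).
Proof.
elim/gen => [|x y Hx Hy|l r le_ld].
- by rewrite mulr0 stable_mult0 mulmx0.
- by rewrite mulrBr !stable_multB Hx Hy mulmxBr.
- by rewrite cls_twist !stable_mult_uniserial mul_tensv mul1mx cycle_residuev.
Qed.

Lemma two_acts_by : acts_by (cls (M 0 (m_gt0 : (2 <= m.+1)%N))) (two_fusion m n c).
Proof.
elim/gen => [|x y Hx Hy|l r le_ld].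
- by rewrite mulr0 stable_mult0 mulmx0.
- by rewrite mulrBr !stable_multB Hx Hy mulmxBr.
case: l le_ld => [|l] le_ld.
  by rewrite (cls_dim0 (V := M r le_ld)) // mulr0 stable_mult0 mulmx0.
have [lt_lm|] := ltnP l m.
  have -> : le_ld = ltnW (lt_lm : (l.+2 <= m.+1)%N) by apply: bool_irrelevance.
  rewrite cls_two stable_multD !stable_mult_uniserial mulmxDl !mul_tensv mul1mx.
  by rewrite shift_lengthv // shiftT_lengthv // cycleX_residuev.
(* Length [d]: every class involved is projective, so both sides are 0. *)
move=> le_ml; have eq_lm : l = m by apply/eqP; rewrite eqn_leq le_ml andbT -ltnS.
move: le_ld; rewrite eq_lm => le_ld; have -> : le_ld = leqnn m.+1 by apply: bool_irrelevance.
rewrite cls_two_top stable_multD !stable_mult_uniserial lengthv_max.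
by rewrite !tensv0l mulmx0 addr0.
Qed.

Definition bicommutant_acts (a : R) : Prop :=
  exists2 A, bicommutant (fusion_gen c) A & acts_by a A.

(** Such elements form a subring containing [M(1, 1)] and [M(2, 0)]. Twisting reaches every M(1, r),
    and the fusion rule solved for its longest term gives the other lengths. *)
Lemma bicommutant_acts_all a : bicommutant_acts a.
Proof.
have aB x y : bicommutant_acts x -> bicommutant_acts y -> bicommutant_acts (x - y).
  move=> [A cA xA] [B cB yB]; exists (A - B); first exact: bicommutantB.
  by move=> z; rewrite mulrBl stable_multB xA yB mulmxBl.
have aM x y : bicommutant_acts x -> bicommutant_acts y -> bicommutant_acts (x * y).
  move=> [A cA xA] [B cB yB]; exists (A *m B); first exact: bicommutantM.
  by move=> z; rewrite -mulrA xA yB mulmxA.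
have a1 : bicommutant_acts 1.
  by exists 1%:M; [apply: bicommutant1 | move=> x; rewrite mul1r mul1mx].
have a0 : bicommutant_acts 0 by rewrite -(subrr 1); apply: aB.
have a_twist : bicommutant_acts (cls (M 1 (ltn0Sn m))).
  by exists (twist_fusion m n); [apply/bicommutant_gen/Or41 | apply: twist_acts_by].
have a_two : bicommutant_acts (cls (M 0 (m_gt0 : (2 <= m.+1)%N))).
  by exists (two_fusion m n c); [apply/bicommutant_gen/Or43 | apply: two_acts_by].
have aM0 r (le_ld : (0 <= m.+1)%N) : bicommutant_acts (cls (M r le_ld)).
  by rewrite cls_dim0.
have aM1 r (le_ld : (1 <= m.+1)%N) : bicommutant_acts (cls (M r le_ld)).
  have -> : le_ld = ltn0Sn m by apply: bool_irrelevance.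
  by elim: r => [|r IH]; [rewrite cls_one | rewrite -cls_twist; apply: aM].
apply: gen => // l; have [k] := ubnP l.
elim: k l => // k IH [|[|l]] // lt_lk r le_ld.
have e : cls (M r le_ld) = cls (M 0 (m_gt0 : (2 <= m.+1)%N)) * cls (M r (ltnW le_ld)) -
    cls (M (r + c) (ltnW (ltnW le_ld))) by rewrite cls_two addrK.
by rewrite e; apply: aB; [apply: aM => // | ]; apply: IH => //; apply: ltnW.
Qed.

(** The standard basis consists of stable coordinates of uniserial classes, so [x ^+ k = 0] forces
    [A ^+ k = 0]; the normal matrix [A] is then 0, and [x = x * 1]. *)
Lemma stable_mult_nilp x k : x ^+ k = 0 -> stable_mult x = 0.
Proof.
move=> xk; have [A cA xA] := bicommutant_acts_all x.
have xAk j y : stable_mult (x ^+ j * y) = A ^+ j *m stable_mult y.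
  elim: j => [|j IH]; first by rewrite !expr0 mul1r mul1mx.
  by rewrite !exprS -mulrA xA IH mulmxA.
have Ak : A ^+ k = 0.
  apply/matrixP => i j; rewrite [RHS]mxE.
  transitivity ((A ^+ k *m delta_mx j (0 : 'I_1)) i 0); first by rewrite -colE mxE.
  rewrite delta_tensv -(residuev_small (mxtens_unindex j).2).
  rewrite -[basisv int m _]/(lengthv (mxtens_unindex j).1.+1).
  rewrite -(stable_mult_uniserial _ (leqW (ltn_ord (mxtens_unindex j).1))).
  by rewrite -xAk xk mul0r stable_mult0 mxE.
have nA := bicommutant_normal (@fusion_genT m n c) (fusion_gen_comm n_gt0) cA.
by rewrite -[x]mulr1 xA (normal_nilp_mx nA Ak) mul0mx.
Qed.

Definition stable_cls (k : 'I_N) : R :=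
  cls (M (mxtens_unindex k).2 (leqW (ltn_ord (mxtens_unindex k).1))).

Lemma stable_clsE a b :
  stable_cls (mxtens_index (a, b)) = cls (M b (leqW (ltn_ord a))).
Proof. by rewrite /stable_cls mxtens_indexK. Qed.

(** The difference is 0 on [M(l, r)] with [l < d] and the projective class itself for [l = d]. *)
Lemma stable_mult_decomp x :
  x - \sum_k stable_cls k *~
    stable_mult x k 0 \in proj_class_ring (hq := hq).
Proof.
elim/gen: x => [|x y Hx Hy|l r le_ld].
- rewrite stable_mult0 big1 ?subr0 ?rpred0 // => k _; by rewrite mxE mulr0z.
- set s := \sum_k _; have -> : s =
     \sum_k stable_cls k *~
       stable_mult x k 0 -
     \sum_k stable_cls k *~
       stable_mult y k 0.
    by rewrite -sumrB; apply: eq_bigr => k _; rewrite stable_multB !mxE mulrzBr.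
  by rewrite opprD opprK addrACA [- y + _]addrC -[_ - y]opprB rpredB.
rewrite stable_mult_uniserial; case: l le_ld => [|l] le_ld.
  rewrite cls_dim0 // big1 ?subr0 ?rpred0 // => k _.
  by rewrite tensv0l mxE mulr0z.
have [lt_lm|le_ml] := ltnP l m; last first.
  have eq_lm : l = m by apply/eqP; rewrite eqn_leq le_ml andbT -ltnS.
  move: le_ld; rewrite eq_lm => le_ld; have -> : le_ld = leqnn m.+1 by apply: bool_irrelevance.
  rewrite lengthv_max tensv0l big1 ?subr0 => [|k _]; last by rewrite mxE mulr0z.
  apply/asboolP => S _; apply; left; exact: uniserial_projective.
have lt_rn : (r %% n < n)%N by rewrite ltn_mod.
rewrite (bigD1 (mxtens_index (Ordinal lt_lm, Ordinal lt_rn))) //= big1 ?addr0 => [|k].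
  rewrite stable_clsE (cls_uniserial_eq (r' := r) _ le_ld) ?modn_mod //.
  by rewrite tensvE mxtens_indexK !mxE /= eqxx modn_mod eqxx mulr1z subrr rpred0.
rewrite -[k]mxtens_unindexK tensvE mxtens_indexK; case: (mxtens_unindex k) => a b.
rewrite (can_eq (@mxtens_indexK _ _)) xpair_eqE -!val_eqE /= !mxE -natrM mulnb.
by rewrite (modn_small (ltn_ord b)) => /negPf->; rewrite mulr0z.
Qed.

Lemma nilp_proj_class_ring (x : R) k : x ^+ k = 0 -> x \in proj_class_ring (hq := hq).
Proof.
move=> /stable_mult_nilp x0; have := stable_mult_decomp x.
by rewrite x0 big1 ?subr0 // => i _; rewrite mxE mulr0z.
Qed.

End StableGreenRing.

(** * Roots of unity and the conclusion *)

Lemma prim_root_exists (K : closedFieldType) n : n%:R != 0 :> K ->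
  exists w : K, n.-primitive_root w.
Proof.
move=> n_neq0; have n_gt0 : (0 < n)%N by rewrite lt0n; apply: contraNneq n_neq0 => ->.
have [rs E] := closed_field_poly_normal ('X^n - 1 : {poly K}).
have lead1 : lead_coef ('X^n - 1 : {poly K}) = 1 by rewrite lead_coefXnsubC.
rewrite lead1 scale1r in E.
(* The polynomial is separable, so [rs] consists of [n] distinct n-th roots of unity. *)
have : has n.-primitive_root rs.
  apply: has_prim_root => //.
  - by apply/allP => z z_rs; rewrite /root_of_unity E root_prod_XsubC.
  - by rewrite -separable_prod_XsubC -E separable_Xn_sub_1.
  - by have := congr1 (size \o val) E; rewrite /= size_XnsubC // size_prod_XsubC => -[->].
by case/hasP => w _ hw; exists w.
Qed.

Local Open Scope classical_set_scope.

Theorem corollary6p2 (K : closedFieldType) (n d : nat) (q : K)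
    (char0 : [pchar K] =i pred0) (n_ge2 : (2 <= n)%N) (d_ge2 : (2 <= d)%N)
    (d_dvd_n : (d %| n)%N) (hq : d.-primitive_root q) :
  pcring_val @` nilpotents (pcring n hq) = nilpotents (green n hq).
Proof.
have n_neq0 : n%:R != 0 :> K.
  by rewrite ((pcharf0P K).1 char0) -lt0n ltnW.
have [w hw] := prim_root_exists n_neq0.
have qVn : q^-1 ^+ n = 1.
  by case/dvdnP: d_dvd_n => e ->; rewrite mulnC exprM exprVn (prim_expr_order hq) invr1 expr1n.
(* As [d] divides [n], [q^-1] is an n-th root of unity, hence a power of [w]. *)
have [c qc] := prim_rootP hw qVn.
have qw : q * w ^+ c = 1.
  by rewrite -qc mulfV // (prim_root_eq0 hq) -lt0n ltnW.
have valX (y : pcring n hq) k : val (y ^+ k) = val y ^+ k by rewrite rmorphXn.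
have val0 : val (0 : pcring n hq) = 0 by rewrite rmorph0.
apply/seteqP; split=> [_ [y [k yk] <-]|x [k xk]].
  by exists k; rewrite -[pcring_val y]/(val y) -valX yk val0.
have px : x \in proj_class_ring (hq := hq).
  (* With [d = m.+1], the bound [2 <= d] reads [0 < m] by conversion. *)
  case: d hq d_ge2 d_dvd_n x xk {valX val0} => // m hq' m_gt0 _ x xk.
  exact: (nilp_proj_class_ring hw qw n_neq0 m_gt0 xk).
by exists (PCRing px) => //; exists k; apply: val_inj; rewrite valX val0.
Qed.
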